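(* Let $T>0$, $M>0$, $l\in\{2,3,\ldots\}$, $\Omega=[0,T]^l$, let $r\ge1$ be an integer and $\gamma>0$ a real number, and let $s$ be the integer $s=r+\gamma$ if $\gamma$ is an integer and $s=r+[\gamma]+1$ if $\gamma$ is not an integer. Let $Q^{**}_{r,\gamma}(\Omega,M)$ be the class of functions defined in the context. Then $$\delta_n\bigl(Q^{**}_{r,\gamma}(\Omega,M),C(\Omega)\bigr)\asymp d_n\bigl(Q^{**}_{r,\gamma}(\Omega,M),C(\Omega)\bigr)\asymp n^{-s/l}.$$
   Context: The class $Q^{**}_{r,\gamma}(\Omega,M)$, $\Omega=[0,T]^l$, consists of the functions $f(t_1,\ldots,t_l)$ defined on $\Omega$ such that, for multi-indices $k=(k_1,\ldots,k_l)$ with $|k|=k_1+\cdots+k_l$, $$\left|\frac{\partial^{|k|}f(t)}{\partial t_1^{k_1}\cdots\partial t_l^{k_l}}\right|\le M,\quad 0\le|k|\le r,\ t\in\Omega,$$ $$\left|\frac{\partial^{|k|}f(t)}{\partial t_1^{k_1}\cdots\partial t_l^{k_l}}\right|\le\frac{M}{(\rho(t,0))^{|k|-r-\zeta}},\quad r<|k|\le s,\ t\in\Omega,\ t\ne0.$$ Here $s=r+\gamma$ and $\zeta=0$ if $\gamma$ is an integer; if $\gamma$ is not an integer, write $\gamma=[\gamma]+\mu$ with $0<\mu<1$ ($[\gamma]$ is the integer part) and put $s=r+[\gamma]+1$, $\zeta=1-\mu$. The quantity $\rho(t,0)=\max_{k=1,\ldots,l}|t_k|$ is the distance from $t$ to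 the origin. $C(\Omega)$ is the Banach space of continuous functions on $\Omega$ with the maximum norm. For a Banach space $B$ and a set $X\subset B$, the Kolmogorov $n$-width is $$d_n(X,B)=\inf_{L^n}\sup_{x\in X}\inf_{u\in L^n}\|x-u\|,$$ the outer infimum being over all $n$-dimensional linear subspaces $L^n$ of $B$. The Babenko $n$-width is $$\delta_n(X,B)=\inf_{\Pi:X\to\mathbb{R}^n}\ \sup_{x\in X}\operatorname{diam}\Pi^{-1}(\Pi(x)),$$ the infimum being over all continuous mappings $\Pi:X\to\mathbb{R}^n$ (continuity and diameter taken with respect to the norm of $B$). For positive sequences, $a_n\asymp b_n$ means that there are constants $c_1,c_2>0$ independent of $n$ with $c_1b_n\le a_n\le c_2b_n$ for all sufficiently large $n$. *)

(* Defs.v *)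
From HB Require Import structures.
From mathcomp Require Import all_boot all_order all_algebra.
From mathcomp Require Import all_classical all_reals all_analysis.
From mathcomp Require Import ring.

Set Implicit Arguments.
Unset Strict Implicit.
Unset Printing Implicit Defensive.

Import Order.TTheory GRing.Theory Num.Theory.
Import numFieldNormedType.Exports.

Local Open Scope classical_set_scope.
Local Open Scope ring_scope.

Definition cube (R : realType) (l : nat) (T : R) : set 'rV[R]_l :=
  [set t | forall i, 0 <= t ord0 i <= T].
Arguments cube {R} l T.

Section CubeFun.
Context (R : realType) (l : nat) (T : R).

Definition ctsfun : {pred cube l T -> R} := fun f => `[< continuous f >].

Record cubeC := CubeC { cubefun :> cube l T -> R; _ : cubefun \in ctsfun }.

HB.instance Definition _ := [isSub for cubefun].
HB.instance Definition _ := [Choice of cubeC by <:].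

Lemma ctsfunP (f : cube l T -> R) : reflect (continuous f) (f \in ctsfun).
Proof. exact: asboolP. Qed.

Lemma cubeC_cts (f : cubeC) : continuous f.
Proof. by have /ctsfunP := valP f. Qed.

Lemma ctsfun_submod_closed : submod_closed ctsfun.
Proof.
split; first by apply/ctsfunP; exact: (@cst_continuous _ _ (0 : R)).
move=> a f g /ctsfunP cf /ctsfunP cg; apply/ctsfunP => t.
apply: continuousD; last exact: cg.
apply: (@continuousM _ _ (cst a) f); [exact: cst_continuous|exact: cf].
Qed.

HB.instance Definition _ :=
  GRing.isSubmodClosed.Build R (cube l T -> R) ctsfun ctsfun_submod_closed.
HB.instance Definition _ := [SubChoice_isSubLmodule of cubeC by <:].

Lemma cubeC_ext (f g : cubeC) : f =1 g -> f = g.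
Proof. by move=> fg; apply: val_inj; apply/funext. Qed.

Lemma cubeC_bounded (f : cubeC) : has_ubound [set `|f t| | t in setT].
Proof.
have cptQ : compact (cube l T).
  rewrite (_ : cube l T = [set t | forall i, `[0, T]%classic (t ord0 i)]).
    apply: (@rV_compact R l (fun=> `[0, T]%classic)) => _.
    exact: segment_compact.
  by apply/seteqP; split=> t /= tQ i; have := tQ i; rewrite in_itv.
have /continuous_compact/(_ cptQ)/compact_bounded[M [_ fM]] :=
  (subspace_valL_continuousP _ (f : _ -> R)).2 (@cubeC_cts f).
exists (M + 1) => _ [t _ <-].
apply: (fM (M + 1)); first by rewrite ltrDl.
exists (val t); first by case: t => t /= /set_mem.
by have /(congr1 (fun h => h t)) := valLK point f.
Qed.

(* The maximum norm; [sup set0 = 0] covers the empty cube ([T < 0]). *)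
Definition supnorm (f : cubeC) : R := sup [set `|f t| | t in setT].

Lemma le_supnorm (f : cubeC) t : `|f t| <= supnorm f.
Proof. by apply: ub_le_sup; [exact: cubeC_bounded|exists t]. Qed.

Lemma supnorm_le (f : cubeC) c :
  0 <= c -> (forall t, `|f t| <= c) -> supnorm f <= c.
Proof.
move=> c0 fc; rewrite /supnorm.
have [->|/set0P] := eqVneq [set `|f t| | t in setT] set0; first by rewrite sup0.
by move=> f0; apply: ge_sup => // _ [t _ <-].
Qed.

Lemma supnorm_ge0 (f : cubeC) : 0 <= supnorm f.
Proof.
rewrite /supnorm.
have [->|/set0P[_ [t _ _]]] := eqVneq [set `|f t| | t in setT] set0.
  by rewrite sup0.
exact: le_trans (normr_ge0 _) (le_supnorm f t).
Qed.

Lemma supnormD (f g : cubeC) : supnorm (f + g) <= supnorm f + supnorm g.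
Proof.
apply: supnorm_le => [|t]; first by rewrite addr_ge0 ?supnorm_ge0.
by rewrite (le_trans (ler_normD _ _))// lerD ?le_supnorm.
Qed.

Lemma supnormZ_le (a : R) (f : cubeC) : supnorm (a *: f) <= `|a| * supnorm f.
Proof.
apply: supnorm_le => [|t]; first by rewrite mulr_ge0 ?supnorm_ge0.
by rewrite normrM ler_wpM2l// le_supnorm.
Qed.

Lemma supnormZ (a : R) (f : cubeC) : supnorm (a *: f) = `|a| * supnorm f.
Proof.
apply/eqP; rewrite eq_le supnormZ_le/=.
have [->|a0] := eqVneq a 0; first by rewrite normr0 mul0r supnorm_ge0.
rewrite -ler_pdivlMl ?normr_gt0// -normfV.
by rewrite -[X in supnorm X <= _](scalerK a0) supnormZ_le.
Qed.

Lemma supnorm0_eq0 (f : cubeC) : supnorm f = 0 -> f = 0.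
Proof.
move=> f0; apply: cubeC_ext => t; apply/eqP.
by rewrite -normr_le0 -f0 le_supnorm.
Qed.

HB.instance Definition _ :=
  Lmodule_isNormed.Build R cubeC supnormD supnormZ supnorm0_eq0.

Lemma cubeC_normE (f : cubeC) : `|f| = sup [set `|f t| | t in setT].
Proof. by []. Qed.

Lemma cubeC_complete (F : set_system cubeC) :
  ProperFilter F -> cauchy F -> cvg F.
Proof.
move=> FF /cauchy_ballP Fc.
pose close (e : R) (f g : cubeC) := forall t, `|f t - g t| <= e.
have Fcauchy e : 0 < e -> \forall f & g \near F, close e f g.
  move=> /Fc; apply: filterS => -[f g]; rewrite -ball_normE /= => fg t.
  exact: le_trans (le_supnorm (f - g) t) (ltW fg).
have Fpt t : cvg ((fun f : cubeC => f t) @ F).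
  apply/cauchy_cvgP/cauchy_ballP => e e0; rewrite near_map2.
  have := Fcauchy (e / 2) (divr_gt0 e0 (ltr0Sn _ 1)).
  apply: filterS => -[f g] /(_ t) fg; rewrite -ball_normE /=.
  by rewrite (le_lt_trans fg)// ltr_pdivrMr// ltr_pMr// ltr1n.
pose g t := lim ((fun f : cubeC => f t) @ F).
pose gclose (e : R) (f : cubeC) := forall t, `|g t - f t| <= e.
have Funif e : 0 < e -> \forall f \near F, gclose e f.
  move=> e0; have e20 : 0 < e / 2 by rewrite divr_gt0.
  have := Fcauchy _ e20 => /nearP_dep; apply: filterS => f Ff t.
  have /cvgrPdist_le/(_ _ e20) Fh := Fpt t.
  have [h [gh fh]] := filter_ex (filterI Fh Ff).
  rewrite -(subrKA (h t)) (le_trans (ler_normD _ _))//.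
  by rewrite (splitr e) lerD// distrC; exact: fh.
have cg : g \in ctsfun.
  apply/ctsfunP => t.
  have Ft : Filter (nbhs t) by exact: nbhs_filter.
  apply/(@cvgrPdist_le R R (cube l T) (nbhs t)) => e e0.
  have e30 : 0 < e / 3 by rewrite divr_gt0.
  have [f gf] := filter_ex (Funif _ e30).
  have /cvgrPdist_le/(_ _ e30) : f x @[x --> t] --> f t by exact: cubeC_cts.
  apply: filterS => u ftu.
  have -> : g t - g u = (g t - f t) + (f t - f u) + (f u - g u).
    by rewrite !subrKA.
  have -> : e = e / 3 + e / 3 + e / 3 by field.
  rewrite (le_trans (ler_normD _ _))// lerD ?[`|f u - g u|]distrC//.
  by rewrite (le_trans (ler_normD _ _))// lerD.
apply/cvg_ex; exists (CubeC cg); apply/cvgrPdist_le => e e0.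
apply: filterS (Funif _ e0) => f gf.
exact: (@supnorm_le (CubeC cg - f) e (ltW e0) gf).
Qed.

HB.instance Definition _ := Uniform_isComplete.Build cubeC cubeC_complete.

End CubeFun.

Definition asymp (R : realType) (a b : nat -> \bar R) : Prop :=
  exists c1 c2 : R, [/\ 0 < c1, 0 < c2 &
    \forall n \near \oo,
      (c1%:E * b n <= a n)%E /\ (a n <= c2%:E * b n)%E].

(* The widths take values in [\bar R], so that all infima and suprema are
   genuine ones. *)
Section Widths.
Context (R : realType) (B : completeNormedModType R).

Definition lin_indep n (e : 'I_n -> B) : Prop :=
  forall c : 'I_n -> R, \sum_i c i *: e i = 0 -> forall i, c i = 0.

Definition lin_span n (e : 'I_n -> B) : set B :=
  [set \sum_i c i *: e i | c in [set: 'I_n -> R]].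

(* [B] is infinite-dimensional in general, hence has no [vectType] structure:
   an n-dimensional subspace is the span of n independent vectors. *)
Definition subspace_of_dim n : set (set B) :=
  [set L | exists2 e : 'I_n -> B, lin_indep e & L = lin_span e].

Definition kolmogorov_width (n : nat) (X : set B) : \bar R :=
  ereal_inf [set ereal_sup
    [set ereal_inf [set `|x - u|%:E | u in L] | x in X]
    | L in subspace_of_dim n].

Definition diam (A : set B) : \bar R :=
  ereal_sup [set `|x - y|%:E | x in A & y in A].

(* A continuous map X -> R^n is given by a function on [B] that is continuous
   on X; its values outside X are not used. *)
Definition babenko_width (n : nat) (X : set B) : \bar R :=
  ereal_inf [set ereal_sup
    [set diam (X `&` [set y | Pi y = Pi x]) | x in X]
    | Pi in [set Pi : B -> 'rV[R]_n | {within X, continuous Pi}]].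

End Widths.

Section WeightedClass.
Context (R : realType) (l : nat).
Implicit Types (k : {ffun 'I_l -> nat}) (i : 'I_l) (t : 'rV[R]_l).

Definition mdegree k : nat := (\sum_i k i)%N.

Definition mincr k i : {ffun 'I_l -> nat} := [ffun j => (k j + (j == i))%N].

(* [d] is the i-th partial derivative of [g] at [t] relative to [Om]: the
   increments keep the argument inside [Om], so that the derivative is one-sided
   on the faces of the cube. *)
Definition is_partial (Om : set 'rV[R]_l) (g : 'rV[R]_l -> R) i t (d : R) :
    Prop :=
  h^-1 * (g (t + h *: delta_mx ord0 i) - g t)
    @[h --> within [set h | Om (t + h *: delta_mx ord0 i)] 0^'] --> d.

Definition sorder (r : nat) (gamma : R) : nat :=
  if gamma \is a Num.int then (r + Num.truncn gamma)%N
  else (r + Num.truncn gamma).+1.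

(* The fractional part mu is [gamma - (Num.truncn gamma)%:R]. *)
Definition zeta (gamma : R) : R :=
  if gamma \is a Num.int then 0 else 1 - (gamma - (Num.truncn gamma)%:R).

(* [D k] is the partial derivative of multi-index [k] of [f], on the whole cube
   for |k| <= r and on the cube minus the origin for r < |k| <= s. The values of
   [D] at other points are irrelevant. *)
Definition is_derivatives (T : R) (r s : nat) (f : cube l T -> R)
    (D : {ffun 'I_l -> nat} -> 'rV[R]_l -> R) : Prop :=
  [/\ forall t : cube l T, D [ffun=> 0%N] (val t) = f t,
      forall k i t, (mdegree k < r)%N -> cube l T t ->
        is_partial (cube l T) (D k) i t (D (mincr k i) t) &
      forall k i t, (r <= mdegree k < s)%N -> cube l T t -> t != 0 ->
        is_partial (cube l T) (D k) i t (D (mincr k i) t)].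

(* The norm of ['rV[R]_l] is the maximum norm, i.e. [`|t|] is rho(t, 0). *)
Definition Qss (T : R) (r : nat) (gamma M : R) (f : cube l T -> R) : Prop :=
  exists2 D, is_derivatives r (sorder r gamma) f D &
    (forall k t, (mdegree k <= r)%N -> cube l T t -> `|D k t| <= M) /\
    (forall k t, (r < mdegree k <= sorder r gamma)%N -> cube l T t -> t != 0 ->
      `|D k t| <= M / `|t| `^ ((mdegree k)%:R - r%:R - zeta gamma)).

(* For r >= 1 every function satisfying [Qss] has bounded first derivatives,
   hence is continuous. *)
Definition Qssclass (T : R) (r : nat) (gamma M : R) : set (cubeC l T) :=
  [set f | Qss r gamma M f].

End WeightedClass.
Arguments Qssclass {R} l T r gamma M.

(* Main.v *)
Require Import Defs.
From mathcomp Require Import all_boot all_order all_algebra.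
From mathcomp Require Import all_classical all_reals all_analysis.
From mathcomp Require Import ring lra.

Set Implicit Arguments.
Unset Strict Implicit.
Unset Printing Implicit Defensive.

Import Order.TTheory GRing.Theory Num.Theory.
Import numFieldNormedType.Exports.

Local Open Scope classical_set_scope.
Local Open Scope ring_scope.

(** Upper bound.  In the dyadic shell [rho / 2 < |t| <= rho] a Taylor polynomial
    of order [s] on a cube of side [h] errs by at most [C h^s rho^(-gamma)], so
    [h^s ~ rho^gamma N^(-s)] equalizes the error at [N^(-s)].  As [gamma < s],
    the numbers of cubes per shell decay geometrically and sum to [O(N^l)]; near
    the origin a single constant suffices.  These piecewise polynomials jump
    between cubes; the functions of the class being Lipschitz, interpolating
    samples on a much finer net makes the approximants continuous without
    changing their number.  Finally, the Babenko width is at most twice the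
    Kolmogorov width: with a partition of unity subordinate to a finite net of
    the (precompact) class, near-best approximants depend continuously on the
    function.

    Lower bound.  Bumps on [m^l > n] disjoint cubes span a copy of the cube
    [[0, 1]^(m^l)] with [c m^(-s)] times its maximum norm inside the class, so
    it is enough that a continuous [G : [0, 1]^N -> R^n] with [n < N]
    identifies two points of opposite faces.  Otherwise Lipschitz functions
    [u_i] on [R^n] separate the images of the [i]-th pair of opposite faces; by
    Poincare-Miranda [u \o G] is onto the [N]-cube, although it factors through
    a bounded subset of [R^n] by the Lipschitz map [u], which contradicts a count of
    separated points.  Poincare-Miranda itself is a parity argument: the cup
    product of the coboundaries of [N] face-compatible 0/1-labellings of a grid
    sums to [1] modulo 2, by Stokes and induction on the dimension. *)

(** * The cubical Poincare-Miranda theorem modulo 2 *)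

Section CubicalMiranda.
Variables (N : nat).
Local Notation point := {ffun 'I_N -> nat}.
Variable f : 'I_N -> point -> 'F_2.
Implicit Types (i j : 'I_N) (s : seq 'I_N).
Implicit Types (S : {set 'I_N}) (x : point).

Lemma F2_addrr (a : 'F_2) : a + a = 0.
Proof. by case: a => -[|[|]] // i; apply: val_inj. Qed.

Lemma F2_opp (a : 'F_2) : - a = a.
Proof. by apply/eqP; rewrite eq_sym -addr_eq0 F2_addrr. Qed.

(* The cup product of the coboundaries of the [f i], [i] in [s], evaluated on
   the cube with lowest vertex [x] and directions [S], triangulated by the
   monotone paths from [x]. *)
Fixpoint cup s S x : 'F_2 :=
  if s is i :: s' then
    \sum_(j in S) (f i (mincr x j) + f i x) * cup s' (S :\ j) (mincr x j)
  else 1.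

Lemma mincrC x i j : mincr (mincr x i) j = mincr (mincr x j) i.
Proof. by apply/ffunP => a; rewrite !ffunE addnAC. Qed.

(** The pairs [(i, j)] and [(j, i)] contribute equally, so they cancel modulo 2. *)
Lemma sum_sym_F2 S (F : 'I_N -> 'I_N -> 'F_2) : (forall i j, F i j = F j i) ->
  \sum_(i in S) \sum_(j in S :\ i) F i j = 0.
Proof.
move=> Fsym; rewrite (eq_bigr (fun i : 'I_N => \sum_(j in S | (j < i)%N) F i j +
   \sum_(j in S | (i < j)%N) F i j)); last first.
  move=> i _; rewrite (bigID (fun j : 'I_N => (j < i)%N)) /=; congr (_ + _).
    by apply: eq_bigl => j; rewrite !inE -val_eqE; case: ltngtP; rewrite ?andbF ?andbT.
  by apply: eq_bigl => j; rewrite !inE -leqNgt -val_eqE; case: ltngtP;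
      rewrite ?andbF ?andbT.
rewrite big_split /= [X in _ + X](exchange_big_dep (mem S)) /=; last first.
  by move=> i j _ /andP[].
rewrite -big_split big1 // => i iS /=.
rewrite -[RHS](F2_addrr (\sum_(j in S | (j < i)%N) F i j)); congr (_ + _).
by apply: eq_big => [j|j _]; [rewrite iS andbA|apply: Fsym].
Qed.

(** A cup product of coboundaries is a cocycle. Expanding the first factor over two directions [j],
    [k], the terms with [f a] at [mincr (mincr x j) k] or at [x] are symmetric in [j] and [k]; those
    with [f a] at [mincr x j] or [mincr x k] cancel each other after exchanging [j] and [k]. *)
Lemma cup_closed s S x :
  \sum_(j in S) (cup s (S :\ j) (mincr x j) + cup s (S :\ j) x) = 0.
Proof.
elim: s S x => [|a s IH] S x; first by rewrite big1 // => j _; rewrite F2_addrr.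
have cl S' x' : \sum_(j in S') cup s (S' :\ j) (mincr x' j) =
    \sum_(j in S') cup s (S' :\ j) x'.
  apply/eqP; rewrite -subr_eq0 -sumrB; apply/eqP; rewrite -[RHS](IH S' x').
  by apply: eq_bigr => j _; rewrite F2_opp.
have D2 j k : S :\ j :\ k = S :\ k :\ j by rewrite !finset.setDDl finset.setUC.
rewrite (eq_bigr (fun j =>
  \sum_(k in S :\ j) f a (mincr (mincr x j) k) * cup s (S :\ j :\ k) (mincr (mincr x j) k)
  + (f a (mincr x j) * \sum_(k in S :\ j) cup s (S :\ j :\ k) (mincr x j)
  + \sum_(k in S :\ j) f a (mincr x k) * cup s (S :\ j :\ k) (mincr x k)
  + f a x * \sum_(k in S :\ j) cup s (S :\ j :\ k) x))); last first.
  move=> j _ /=; rewrite -!cl !mulr_sumr -!big_split /=.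
  by apply: eq_bigr => k _; rewrite !mulrDl !addrA.
rewrite big_split /= sum_sym_F2 ?add0r; last by move=> i j; rewrite mincrC D2.
rewrite !big_split /= -mulr_sumr [X in _ * X]sum_sym_F2 ?mulr0 ?addr0; last first.
  by move=> i j; rewrite D2.
rewrite [X in _ + X](exchange_big_dep (mem S)) /=; last first.
  by move=> i j _; rewrite !inE => /andP[].
rewrite -big_split big1 // => j jS /=.
rewrite mulr_sumr -[RHS](F2_addrr (\sum_(k in S :\ j) f a (mincr x j) * cup s (S :\ j :\ k) (mincr x j))).
congr (_ + _); apply: eq_big => [k|k _]; last by rewrite D2.
by rewrite !inE jS andbT eq_sym andbC.
Qed.

(** No path moves in a direction outside [S], so the factor of [f j] is a difference of two equal
    values. *)
Lemma cup_const s S x j : j \notin S -> j \in s ->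
  (forall y y' : point, y j = x j -> y' j = x j -> f j y = f j y') -> cup s S x = 0.
Proof.
move=> jS; elim: s S x jS => // i s IH S x jS; rewrite inE => js fc.
rewrite /= big1 // => k kS; have xk : mincr x k j = x j.
  by rewrite ffunE; case: eqVneq => [jk|]; rewrite ?addn0 //; rewrite jk kS in jS.
have [->|ij] := eqVneq i j; first by rewrite (fc (mincr x k) x) // F2_addrr mul0r.
rewrite IH ?mulr0 ?inE ?(negPf jS) ?andbF // => [|y y' yx y'x]; last by apply: fc; rewrite ?yx ?y'x.
by case/orP: js => // /eqP ji; rewrite ji eqxx in ij.
Qed.

Lemma cup_neq0 s S x i : cup s S x != 0 -> i \in s ->
  exists u v : point, [/\ forall j, (x j <= u j <= (x j).+1)%N,
    forall j, (x j <= v j <= (x j).+1)%N & f i u != f i v].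
Proof.
(* Confining [u] and [v] to the face spanned by [S] lets the induction pass to [S :\ j] based at
   [mincr x j]. *)
suff H : cup s S x != 0 -> i \in s ->
  exists u v : point, [/\ forall j, (x j <= u j <= x j + (j \in S))%N,
    forall j, (x j <= v j <= x j + (j \in S))%N & f i u != f i v].
  move=> /H {}H /H [u [v [xu xv uv]]]; exists u, v.
  by split=> // j; [move: (xu j)|move: (xv j)]; case: (j \in S); rewrite ?addn1 // addn0;
    move=> /andP[-> /leqW ->].
elim: s S x => // k s IH S x /=; have [/existsP[j] |] := boolP [exists j in S,
   (f k (mincr x j) + f k x) * cup s (S :\ j) (mincr x j) != 0]; last first.
  rewrite negb_exists_in => /'forall_implyP F; rewrite big1 ?eqxx // => j jS.
  by apply/eqP; rewrite -[_ == _]negbK F.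
rewrite mulf_eq0 negb_or addr_eq0 F2_opp => /and3P[jS fj] /IH {}IH _.
rewrite inE => /predU1P[-> |/IH[u [v [xu xv uv]]]].
  exists (mincr x j), x; split=> // a; rewrite ?leqnn ?ffunE leq_addr //= leq_add2l.
  by case: eqVneq => [->|]; rewrite ?jS.
have H w : (forall a, mincr x j a <= w a <= mincr x j a + (a \in S :\ j))%N ->
    (forall a, x a <= w a <= x a + (a \in S))%N.
  move=> xw a; move: (xw a); rewrite !ffunE !inE; case: eqVneq => [->|_] /=.
    by rewrite jS addn0 => /andP[/(leq_trans _) -> //]; rewrite leq_addr.
  by rewrite !addn0.
by exists u, v; split=> //; exact: H.
Qed.

Variable K : nat.
Hypothesis K_gt0 : (0 < K)%N.
Local Notation gpoint := {ffun 'I_N -> 'I_K.+1}.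
Implicit Type p : gpoint.

Definition npoint p : point := [ffun i => val (p i)].

(** Lowest vertices of the unit cubes that tile one face of the grid, namely the face through the
    far corner with directions [S]. *)
Definition cells S p := [forall i, if i \in S then (p i < K)%N else val (p i) == K].

Definition setcoord p j (a : 'I_K.+1) : gpoint := [ffun i => if i == j then a else p i].

(** On a grid line in direction [j] every inner vertex occurs twice, once as upper and once as lower
    end of an edge; only the two extreme vertices survive modulo 2. *)
Lemma telescope_cells S j (G : point -> 'F_2) : j \in S ->
  \sum_(p | cells S p) (G (mincr (npoint p) j) + G (npoint p)) =
  \sum_(p | cells (S :\ j) p) (G (npoint (setcoord p j ord0)) + G (npoint p)).
Proof.
move=> jS; pose C p := [forall i, (i != j) ==> if i \in S then (p i < K)%N else val (p i) == K].
have Cset p a : C (setcoord p j a) = C p.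
  by apply: eq_forallb => i; rewrite ffunE; case: eqVneq.
have cE p : cells S p = C p && (p j < K)%N.
  apply/forallP/andP => [Cp|[/forallP Cp pj] i].
    by split; [apply/forallP => i; apply/implyP => _|have := Cp j; rewrite jS].
  by have := Cp i; case: eqVneq => [->|_] //=; rewrite jS.
have cE' p : cells (S :\ j) p = C p && (val (p j) == K).
  apply/forallP/andP => [Cp|[/forallP Cp pj] i].
    split; last by have := Cp j; rewrite !inE eqxx.
    by apply/forallP => i; apply/implyP => ij; have := Cp i; rewrite !inE ij.
  by have := Cp i; rewrite !inE; case: eqVneq => [->|_].
have shift : \sum_(p | C p && (p j < K)%N) G (mincr (npoint p) j) =
    \sum_(p | C p && (0 < p j)%N) G (npoint p).
  rewrite (reindex_onto (fun p => setcoord p j (inord (p j).-1))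
     (fun p => setcoord p j (inord (p j).+1))) /=; last first.
    move=> p /andP[_ pj]; apply/ffunP => i; rewrite !ffunE eqxx; case: eqVneq => [->|//].
    by rewrite inordK ?ltnS //= inord_val.
  apply: eq_big => p.
    rewrite Cset -andbA; case: (C p) => //=; rewrite !ffunE eqxx.
    have pK := ltn_ord (p j).
    rewrite inordK; last by rewrite (leq_ltn_trans (leq_pred _)).
    case: (posnP (p j)) => [p0|p0].
      apply/negbTE; rewrite negb_and; apply/orP; right; apply/eqP => /ffunP/(_ j).
      rewrite !ffunE eqxx p0 => /(congr1 val) /=; rewrite inordK ?p0 //.
    rewrite prednK // -ltnS pK /=; apply/eqP/ffunP => i.
    by rewrite !ffunE; case: eqVneq => [->|//]; rewrite inord_val.
  move=> /andP[/andP[_ _] /eqP /ffunP/(_ j)]; rewrite !ffunE eqxx => pj; congr G.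
  have pK := ltn_ord (p j).
  have pK' : ((p j).-1 < K.+1)%N by rewrite (leq_ltn_trans (leq_pred _)).
  have p0 : (0 < p j)%N.
    rewrite lt0n; apply/eqP => p0; move/(congr1 val): pj; rewrite /= p0 inordK //=; rewrite ?inordK // ltnS.
  apply/ffunP => i; rewrite !ffunE; case: (eqVneq i j) => [->|_]; last by rewrite addn0.
  by rewrite /= inordK // addn1 prednK.
have face0 : \sum_(p | C p && (val (p j) == K)) G (npoint (setcoord p j ord0)) =
    \sum_(p | C p && (val (p j) == 0%N)) G (npoint p).
  rewrite [RHS](reindex_onto (fun p => setcoord p j ord0) (fun p => setcoord p j ord_max)) /=.
    apply: eq_bigl => p; rewrite Cset !ffunE eqxx /= andbT; congr (_ && _).
    apply/eqP/eqP => [pj|/ffunP/(_ j)]; last by rewrite !ffunE eqxx => <-.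
    apply/ffunP => i; rewrite !ffunE; case: eqVneq => [->|//].
    by apply: val_inj; rewrite /= pj.
  move=> p /andP[_ /eqP pj]; apply/ffunP => i; rewrite !ffunE; case: eqVneq => [->|//].
  by apply: val_inj; rewrite /= pj.
rewrite (eq_bigl _ _ cE) (eq_bigl _ _ cE') !big_split /= shift face0.
rewrite (bigID (fun p => (p j < K)%N)) /= [X in _ + X](bigID (fun p => (0 < p j)%N)) /=.
(* [A] collects the inner vertices [0 < p j < K], which both sums contain; it cancels and the ends
   remain. *)
set A := (X in X + _ + _); set D := (X in _ = _ + X).
rewrite [X in _ + X + _](_ : _ = D); last first.
  apply: eq_bigl => p; rewrite -andbA -leqNgt; congr (_ && _).
  have := ltn_ord (p j); rewrite ltnS /= => pK; rewrite eqn_leq pK /=.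
  by case: (leqP K (p j)) => [Kp|]; rewrite ?andbF // (leq_trans K_gt0 Kp).
rewrite [X in _ + (X + _)](_ : _ = A); last first.
  by apply: eq_bigl => p; rewrite andbAC.
rewrite [X in _ + (_ + X)](_ : _ = \sum_(p | C p && (val (p j) == 0%N)) G (npoint p)); last first.
  apply: eq_bigl => p; rewrite -andbA -leqNgt leqn0; congr (_ && _).
  by case: eqP => [->|]; rewrite ?K_gt0 ?andbF.
by rewrite addrACA F2_addrr add0r addrC.
Qed.

Hypothesis f0 : forall i (x : point), x i = 0%N -> f i x = 0.
Hypothesis f1 : forall i (x : point), x i = K -> f i x = 1.

(** Stokes: the cup product is the coboundary of [f i] times a cocycle, so its sum reduces to the
    faces [p j = 0] and [p j = K]. For [j != i] the factor [f j] is constant there and the product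
    vanishes; for [i] the face at [0] contributes [0] and the face at [K] gives the sum for the
    shorter list. *)
Lemma sum_cup_grid s : uniq s ->
  \sum_(p | cells [set i in s] p) cup s [set i in s] (npoint p) = 1.
Proof.
elim: s => [|i s IH] /=.
  rewrite (big_pred1 [ffun=> ord_max]) // => p; apply/forallP/eqP => [Cp|-> i].
    by apply/ffunP => i; have := Cp i; rewrite ffunE inE /= => /eqP pi; exact: val_inj.
  by rewrite inE /= ffunE.
move=> /andP[is_ us]; set S := [set j in i :: s].
have iS : i \in S by rewrite !inE eqxx.
have SE : S :\ i = [set j in s].
  by apply/setP => j; rewrite !inE; case: eqVneq => //= ->; rewrite (negPf is_).
(* Adding [f i (npoint p)] times the vanishing sum of [cup_closed] completes the expression to a
   full coboundary, ready for telescoping. *)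
have cupE p : \sum_(j in S) (f i (mincr (npoint p) j) + f i (npoint p)) * cup s (S :\ j) (mincr (npoint p) j)
  = \sum_(j in S) (f i (mincr (npoint p) j) * cup s (S :\ j) (mincr (npoint p) j) +
       f i (npoint p) * cup s (S :\ j) (npoint p)).
  apply/eqP; rewrite -subr_eq0 -sumrB; apply/eqP; rewrite -[RHS](mulr0 (f i (npoint p))).
  rewrite -[X in _ = _ * X](cup_closed s S (npoint p)) mulr_sumr; apply: eq_bigr => j _.
  by rewrite mulrDl opprD addrACA subrr add0r F2_opp mulrDr.
rewrite (eq_bigr _ (fun p _ => cupE p)) exchange_big /= (bigD1 i) //=.
rewrite (telescope_cells (fun x => f i x * cup s (S :\ i) x)) // [X in _ + X]big1 ?addr0; last first.
  move=> j /andP[jS ji]; rewrite (telescope_cells (fun x => f i x * cup s (S :\ j) x)) //.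
  have js : j \in s by move: jS; rewrite !inE (negPf ji).
  rewrite big1 // => p /forallP/(_ j); rewrite !inE eqxx /= => /eqP pj.
  rewrite (@cup_const _ _ _ j) ?mulr0 ?add0r ?inE ?eqxx //; last first.
    by move=> y y'; rewrite !ffunE eqxx => y0 y'0; rewrite !f0.
  rewrite (@cup_const _ _ _ j) ?mulr0 ?inE ?eqxx //.
  by move=> y y'; rewrite !ffunE /= pj => y0 y'0; rewrite !f1.
rewrite -[RHS](IH us) SE; apply: eq_bigr => p /forallP/(_ i).
rewrite inE (negPf is_) => /eqP pi.
by rewrite f0 ?ffunE ?eqxx // mul0r add0r f1 ?mul1r // ffunE pi.
Qed.

(** A sum equal to [1] has a nonzero term, and on the cell of that term every labelling takes both
    values. *)
Lemma cubical_miranda : exists2 x : point, forall i, (x i < K)%N &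
  forall i, exists u v : point, [/\ forall j, (x j <= u j <= (x j).+1)%N,
    forall j, (x j <= v j <= (x j).+1)%N & f i u != f i v].
Proof.
have := sum_cup_grid (enum_uniq 'I_N); set S := [set i in _].
have [/existsP[p /andP[/forallP Cp cp]] _ |] :=
    boolP [exists p, cells S p && (cup (enum 'I_N) S (npoint p) != 0)].
  exists (npoint p) => i; first by have := Cp i; rewrite inE mem_enum ffunE.
  by apply: cup_neq0 cp _; rewrite mem_enum.
rewrite negb_exists => /forallP F; rewrite big1 => [/eqP|p Cp]; first by rewrite eq_sym oner_eq0.
by apply/eqP; have := F p; rewrite Cp negbK.
Qed.

End CubicalMiranda.

(** * Fibers of continuous maps to a space of lower dimension *)

Lemma coord_le_norm (R : realType) l (x : 'rV[R]_l) i : `|x ord0 i| <= `|x|.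
Proof.
rewrite [`|x|]mx_normrE.
exact: (@le_bigmax _ _ _ 0 (fun p : 'I_1 * 'I_l => `|x p.1 p.2|) (ord0, i)).
Qed.

Lemma rV_norm_le (R : realType) l (x : 'rV[R]_l) e :
  0 <= e -> (forall i, `|x ord0 i| <= e) -> `|x| <= e.
Proof.
move=> e0 xe; rewrite [`|x|]mx_normrE; apply: bigmax_le => // -[i j] _ /=.
by rewrite (ord1 i).
Qed.

Section Topology.
Variable R : realType.

Lemma cube_compact l (T : R) : compact (cube l T).
Proof.
rewrite (_ : cube l T = [set t | forall i, `[0, T]%classic (t ord0 i)]).
  apply: (@rV_compact R l (fun=> `[0, T]%classic)) => _.
  exact: segment_compact.
by apply/seteqP; split=> t /= tQ i; have := tQ i; rewrite in_itv.
Qed.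

Lemma compact_unif_cont (U V : normedModType R) (K : set U) (f : U -> V) (e : R) :
  compact K -> continuous f -> 0 < e ->
  exists2 d : R, 0 < d & forall x y, K x -> `|x - y| < d -> `|f x - f y| < e.
Proof.
move=> /compact_near_coveringP cK cf e0.
suff : \forall d \near (0^'+ : set_system R), K `<=`
    (fun x => forall y, `|x - y| < d -> `|f x - f y| < e).
  move=> /(filterI (nbhs_right_gt 0)) /filter_ex[d [d0 H]].
  by exists d => // x y Kx; apply: H.
apply: cK => x Kx.
have e2 : 0 < e / 2 by rewrite divr_gt0.
have /cvgrPdist_lt/(_ _ e2)/nbhs_ballP[r r0 rf] := cf x.
have r2 : 0 < r / 2 by rewrite divr_gt0.
exists (ball x (r / 2), [set d | d < r / 2]).
  by split => /=; [exact: nbhsx_ballx|exact: nbhs_right_lt].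
move=> [x' d] [/= xx' dr] y x'y.
have xy : ball x r y.
  rewrite -ball_normE /=; rewrite -ball_normE /= in xx'.
  rewrite (splitr r) -(subrKA x') (le_lt_trans (ler_normD _ _)) // ltrD //.
  exact: lt_trans x'y dr.
have xx : ball x r x'.
  by apply: le_ball xx'; rewrite ler_pdivrMr // ler_pMr // ler1n.
rewrite -(subrKA (f x)) (le_lt_trans (ler_normD _ _)) // (splitr e) ltrD //.
  by rewrite distrC; exact: rf.
exact: rf.
Qed.

(** Label a grid finer than [d] by comparing [phi i] with [y i]: in the cell that [cubical_miranda]
    provides, every [phi i] crosses [y i] while staying within [e] of its value at the base
    point. *)
Lemma poincare_miranda N (phi : 'I_N -> 'rV[R]_N -> R) (y : 'I_N -> R) (d e : R) :
  0 < d -> (forall i x x', cube N 1 x -> cube N 1 x' -> `|x - x'| < d ->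
    `|phi i x - phi i x'| <= e) ->
  (forall i x, cube N 1 x -> x ord0 i = 0 -> phi i x = 0) ->
  (forall i x, cube N 1 x -> x ord0 i = 1 -> phi i x = 1) ->
  (forall i, 0 < y i <= 1) ->
  exists2 x, cube N 1 x & forall i, `|phi i x - y i| <= e.
Proof.
move=> d0 uphi phi0 phi1 y01.
pose K := (Num.truncn d^-1).+1.
have K0 : 0 < K%:R :> R by rewrite ltr0n.
have Kd : K%:R^-1 < d by rewrite invf_plt ?posrE // Num.Theory.truncnS_gt.
pose sc (x : {ffun 'I_N -> nat}) : 'rV[R]_N := \row_i ((x i)%:R / K%:R).
have sc_cube (x : {ffun 'I_N -> nat}) : (forall i, x i <= K)%N -> cube N 1 (sc x).
  move=> xK i; rewrite mxE divr_ge0 //= ler_pdivrMr // mul1r ler_nat //.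
(* The clauses on [x i] impose the boundary labels at all integer points, also outside the grid; on
   the grid the label just compares [y i] with [phi i]. *)
pose lab i (x : {ffun 'I_N -> nat}) : 'F_2 :=
  ((x i != 0%N) && ((x i == K) || (y i <= phi i (sc x))))%:R.
have labE i (x : {ffun 'I_N -> nat}) : (forall j, x j <= K)%N -> lab i x = ((y i <= phi i (sc x))%R : bool)%:R.
  move=> xK; have := y01 i; rewrite /lab => /andP[yi0 yi1].
  have [xi|xi] /= := eqVneq (x i) 0%N.
    rewrite phi0 ?leNgt ?yi0 //; first exact: sc_cube.
    by rewrite mxE xi mul0r.
  have [xi'|//] := eqVneq; rewrite phi1 ?yi1 //; first exact: sc_cube.
  by rewrite mxE xi' divff // gt_eqF.
have [||x xK xf] := @cubical_miranda N lab K isT.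
- by move=> i x xi; rewrite /lab xi.
- by move=> i x xi; rewrite /lab xi eqxx.
exists (sc x) => [|i]; first by apply: sc_cube => i; exact: ltnW.
have near (w : {ffun 'I_N -> nat}) : (forall j, x j <= w j <= (x j).+1)%N ->
    [/\ (forall j, w j <= K)%N & `|phi i (sc x) - phi i (sc w)| <= e].
  move=> xw; have wK j : (w j <= K)%N.
    by have /andP[_ /leq_trans] := xw j; apply; exact: xK.
  split=> //; apply: uphi; [by apply: sc_cube => j; exact: ltnW|exact: sc_cube|].
  apply: le_lt_trans Kd; apply: rV_norm_le => [|j]; first by rewrite invr_ge0 ltW.
  rewrite !mxE -mulrBl normrM (ger0_norm (x := K%:R^-1)) ?invr_ge0 ?(ltW K0) //.
  rewrite ler_piMl ?invr_ge0 ?(ltW K0) // distrC -natrB; last by case/andP: (xw j).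
  by rewrite normr_nat lern1 leq_subLR addn1; case/andP: (xw j).
have [u [v [/near [uK eu] /near [vK ev]]]] := xf i.
rewrite !labE // => luv.
wlog [yu vy] : u v uK eu vK ev luv / y i <= phi i (sc u) /\ phi i (sc v) < y i.
  move=> H; move: luv; case: (lerP (y i) (phi i (sc u))) => yu; case: (lerP (y i) (phi i (sc v))) => yv.
  - by rewrite eqxx.
  - by move=> _; apply: (H u v) => //; rewrite yu leNgt yv.
  - by move=> _; apply: (H v u) => //; rewrite yv leNgt yu.
  - by rewrite eqxx.
move: eu ev; rewrite !ler_norml => /andP[eu _] /andP[_ ev].
by apply/andP; split; lra.
Qed.

Lemma fiber_opposite_faces N n (G : 'rV[R]_N -> 'rV[R]_n) : (n < N)%N ->
  continuous G ->
  exists x y i, [/\ cube N 1 x, cube N 1 y, x ord0 i = 0, y ord0 i = 1 & G x = G y].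
Proof.
move=> nN cG; apply: contrapT => noG.
pose F (a : R) i := [set x : 'rV[R]_N | cube N 1 x /\ x ord0 i = a].
have Fcpt a i : compact (F a i).
  rewrite (_ : F a i = cube N 1 `&` (fun x : 'rV[R]_N => x ord0 i) @^-1` [set a]) //.
  apply: compact_closedI; first exact: cube_compact.
  by apply: closed_comp; [move=> x _; exact: coord_continuous|exact: closed_eq].
(* By compactness, images of opposite faces that never meet keep a uniform distance. *)
have [d d0 dG] : exists2 d, 0 < d & forall i x y, F 0 i x -> F 1 i y -> d < `|G x - G y|.
  suff : \forall d \near (0^'+ : set_system R), forall i,
      (F 0 i `*` F 1 i) `<=` (fun xy => d < `|G xy.1 - G xy.2|).
    move=> /(filterI (nbhs_right_gt 0)) /filter_ex[d [d0 H]].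
    by exists d => // i x y Fx Fy; apply: (H i (x, y)).
  apply: filter_forall => i; have := compact_setX (Fcpt 0 i) (Fcpt 1 i).
  move=> /compact_near_coveringP; apply => -[x y] [/= Fx Fy].
  have c0 : 0 < `|G x - G y|.
    rewrite normr_gt0 subr_eq0; apply/eqP => Gxy; apply: noG.
    by exists x, y, i; case: Fx; case: Fy.
  have c3 : 0 < `|G x - G y| / 3 by rewrite divr_gt0.
  have /cvgrPdist_lt/(_ _ c3) Nx := cG x.
  have /cvgrPdist_lt/(_ _ c3) Ny := cG y.
  have Nd : \forall d \near (0^'+ : set_system R), d < `|G x - G y| / 3 by exact: nbhs_right_lt.
  near=> xy d => /=.
  have Hx : `|G x - G xy.1| < `|G x - G y| / 3 by near: xy; exact: cvg_fst Nx.
  have Hy : `|G y - G xy.2| < `|G x - G y| / 3 by near: xy; exact: cvg_snd Ny.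
  have Hd : d < `|G x - G y| / 3 by near: d.
  have : `|G x - G y| <= `|G x - G xy.1| + `|G xy.1 - G xy.2| + `|G y - G xy.2|.
    by rewrite (distrC (G y)) -{1}(subrKA (G xy.2)) (le_trans (ler_normD _ _)) // lerD2r
       -{1}(subrKA (G xy.1)) ler_normD.
  lra.
pose dist i z := inf [set `|z - G x| | x in F 0 i].
have F0n i : F 0 i !=set0.
  by exists 0; split; [move=> j; rewrite mxE lexx ler01|rewrite mxE].
have dist_lb i z : has_lbound [set `|z - G x| | x in F 0 i] by exists 0 => _ [x _ <-].
have dist_n i z : [set `|z - G x| | x in F 0 i] !=set0.
  by have [x Fx] := F0n i; exists `|z - G x|, x.
have dist_lip i z z' : dist i z <= dist i z' + `|z - z'|.
  rewrite -lerBlDr; apply: lb_le_inf => // _ [x Fx <-]; rewrite lerBlDr.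
  apply: (@le_trans _ _ `|z - G x|); first by apply: ge_inf => //; exists x.
  by rewrite -(subrKA z') addrC ler_normD.
have dist0 i x : F 0 i x -> dist i (G x) = 0.
  move=> Fx; apply/eqP; rewrite eq_le; apply/andP; split.
    by rewrite -(normr0 'rV[R]_n) -(subrr (G x)); apply: ge_inf => //; exists x.
  by apply: lb_le_inf => // _ [y _ <-].
have dist1 i x : F 1 i x -> d <= dist i (G x).
  by move=> Fx; apply: lb_le_inf => // _ [y Fy <-]; rewrite distrC ltW // (dG i).
(* [u i] is Lipschitz with constant [1 / d], equal to [0] on the image of the face [x i = 0] and to
   [1] on that of the opposite face. *)
pose u i z := Num.min 1 (dist i z / d).
have ulip i z z' : `|u i z - u i z'| <= `|z - z'| / d.
  have H a b : u i a - u i b <= `|a - b| / d.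
    rewrite /u; have := dist_lip i a b; rewrite -(ler_pM2r (x := d^-1)) ?invr_gt0 // mulrDl.
    have : 0 <= `|a - b| / d by rewrite divr_ge0 // ltW.
    by rewrite /Order.min; case: ifP; case: ifP; lra.
  by rewrite ler_norml H lerNl opprB distrC H.
have [C C0 GC] : exists2 C, 0 < C & forall x, cube N 1 x -> `|G x| <= C.
  have /compact_bounded[M [_ HM]] :
    compact (G @` cube N 1) by apply: continuous_compact; [exact: continuous_subspaceT|exact: cube_compact].
  exists (`|M| + 1) => [|x cx]; first by rewrite ltr_wpDl.
  by apply: (HM (`|M| + 1)); [rewrite (le_lt_trans (ler_norm M)) // ltrDl|exists x].
(* Since [8 C / d < c], [(c q)^n] boxes of side [e * d = d / (4 q)] cover the image, whereas there
   are [q^N] targets [y a]. The choice [q > c^n] gives [q^N >= q^(n+1) > (c q)^n]. *)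
pose c := (Num.truncn (8 * C / d)).+2; pose q := (c ^ n).+1.
have q0 : 0 < q%:R :> R by rewrite ltr0n.
pose y (a : {ffun 'I_N -> 'I_q}) i : R := (a i).+1%:R / q%:R.
pose e : R := (4 * q%:R)^-1.
have e0 : 0 < e by rewrite invr_gt0 mulr_gt0.
have ed0 : 0 < e * d by rewrite mulr_gt0.
have [dl dl0 Gu] := compact_unif_cont (@cube_compact N 1) cG ed0.
have X a : exists2 x, cube N 1 x & forall i, `|u i (G x) - y a i| <= e.
  apply: (@poincare_miranda N (fun i x => u i (G x)) (y a) dl e dl0).
  - move=> i x x' cx cx' xx'; rewrite (le_trans (ulip _ _ _)) // ler_pdivrMr // ltW //.
    exact: Gu.
  - by move=> i x cx xi; rewrite /u dist0 // mul0r min_r.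
  - move=> i x cx xi; rewrite /u min_l // ler_pdivlMr // mul1r; exact: dist1.
  - by move=> i; rewrite divr_gt0 ?ltr0n //= ler_pdivrMr // mul1r ler_nat ltn_ord.
pose x a := s2val (cid2 (X a)).
have xc a : cube N 1 (x a) by rewrite /x; case: cid2.
have xu a i : `|u i (G (x a)) - y a i| <= e by rewrite /x; case: cid2.
pose h := e * d.
have lb0 a j : 0 <= (G (x a) ord0 j + C) / h.
  rewrite divr_ge0 ?(ltW ed0) //; have := le_trans (coord_le_norm _ j) (GC _ (xc a)).
  by rewrite ler_norml => /andP[]; lra.
have lb1 a j : (Num.truncn ((G (x a) ord0 j + C) / h) < c * q)%N.
  rewrite -(ltr_nat R); have := lb0 a j; rewrite -Num.Theory.truncn_le => /le_lt_trans; apply.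
  rewrite ltr_pdivrMr // natrM.
  have := le_trans (coord_le_norm _ j) (GC _ (xc a)); rewrite ler_norml => /andP[_ GxC].
  have : 8 * C / d < c%:R by rewrite (lt_le_trans (Num.Theory.truncnS_gt _)) ?ler_nat.
  rewrite ltr_pdivrMr // => cd.
  have -> : c%:R * q%:R * h = c%:R * d / 4 by rewrite /h /e; field; rewrite gt_eqF.
  by lra.
pose lab a : {ffun 'I_n -> 'I_(c * q)} := [ffun j => Ordinal (lb1 a j)].
(* In a common box the values of [u i] differ by at most [e], so the targets, each hit up to [e],
   would differ by at most [3 e]; distinct ones differ by at least [1 / q = 4 e]. *)
have labI : injective lab.
  move=> a b ab; apply/ffunP => i; apply/eqP/negP => /negP abi.
  have Gab : `|G (x a) - G (x b)| <= h.
    apply: rV_norm_le => [|j]; first exact: ltW.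
    have /(congr1 val) /= := congr1 (fun f : {ffun _} => f j) ab; rewrite !ffunE /= => tab.
    have := truncn_itv (lb0 a j); have := truncn_itv (lb0 b j).
    rewrite tab !ler_pdivlMr ?ltr_pdivrMr ?ltr_pdivrMr //; set t := Num.truncn _; rewrite -[t.+1%:R]natr1 mulrDl mul1r !mxE => /andP[b1 b2] /andP[a1 a2].
    by rewrite ler_norml; apply/andP; split; lra.
  have uab : `|u i (G (x a)) - u i (G (x b))| <= e.
    by rewrite (le_trans (ulip _ _ _)) // ler_pdivrMr.
  have yab : q%:R^-1 <= `|y a i - y b i|.
    rewrite /y -mulrBl normrM (ger0_norm (x := q%:R^-1)) ?invr_ge0 ?(ltW q0) //.
    rewrite ler_peMl ?invr_ge0 ?(ltW q0) //.
    wlog lab_ : a b abi {ab Gab uab} / (b i < a i)%N.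
      move=> H; case: (ltngtP (a i) (b i)) => [lab_|lab_|/val_inj lab_].
      - by rewrite distrC; apply: H => //; rewrite eq_sym.
      - exact: H.
      - by rewrite lab_ eqxx in abi.
    rewrite -natrB; last by rewrite ltnS ltnW.
    by rewrite normr_nat ler1n subn_gt0.
  have qe : q%:R^-1 = 4 * e by rewrite /e; field; rewrite gt_eqF.
  have := xu a i; have := xu b i; move: uab yab; rewrite qe.
  set ya := y a i; set yb := y b i; set ua := u i _; set ub := u i _ => uab yab ub1 ua1.
  have : `|ya - yb| <= `|ua - ya| + `|ua - ub| + `|ub - yb|.
    rewrite (_ : ya - yb = - (ua - ya) + (ua - ub) + (ub - yb)); last by ring.
    by rewrite -(normrN (ua - ya)) (le_trans (ler_normD _ _)) // lerD2r ler_normD.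
  by lra.
have := leq_card lab labI; rewrite !card_ffun !card_ord leqNgt expnMn.
rewrite (leq_trans _ (leq_pexp2l _ nN)) // expnS ltn_pmul2r ?expn_gt0 //.
Unshelve. all: by end_near.
Qed.

End Topology.

(** * Bounds on widths *)

Section Subspaces.
Variables (R : realType) (B : completeNormedModType R).

Definition snoc k (e : 'I_k -> B) (v : B) : 'I_k.+1 -> B :=
  fun i => if unlift ord_max i is Some j then e j else v.

Lemma sum_snoc k (e : 'I_k -> B) v (c : 'I_k.+1 -> R) :
  \sum_i c i *: snoc e v i = \sum_i c (lift ord_max i) *: e i + c ord_max *: v.
Proof.
rewrite big_ord_recr /= {2}/snoc unlift_none; congr (_ + _); apply: eq_bigr => i _.
have -> : widen_ord (leqnSn k) i = lift ord_max i by apply: ord_inj; rewrite lift_max.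
by rewrite /snoc liftK.
Qed.

Lemma lin_span_snoc k (e : 'I_k -> B) v : lin_span e `<=` lin_span (snoc e v).
Proof.
move=> _ [c _ <-]; exists (fun i => if unlift ord_max i is Some j then c j else 0) => //.
rewrite sum_snoc unlift_none scale0r addr0.
by apply: eq_bigr => i _; rewrite liftK.
Qed.

Lemma lin_span_snoc_last k (e : 'I_k -> B) v : lin_span (snoc e v) v.
Proof.
exists (fun i => if unlift ord_max i is Some j then 0 else 1) => //.
rewrite sum_snoc unlift_none scale1r big1 ?add0r // => i _.
by rewrite liftK scale0r.
Qed.

Lemma lin_span_sum k (e : 'I_k -> B) m (c : 'I_m -> R) (v : 'I_m -> B) :
  (forall i, lin_span e (v i)) -> lin_span e (\sum_i c i *: v i).
Proof.
move=> ev; have /choice[a aE] : forall i, exists a : 'I_k -> R, \sum_j a j *: e j = v i.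
  by move=> i; have [a _ aE] := ev i; exists a.
exists (fun j => \sum_i c i * a i j) => //.
under eq_bigr do rewrite scaler_suml.
rewrite exchange_big; apply: eq_bigr => i _ /=.
by rewrite -aE scaler_sumr; apply: eq_bigr => j _; rewrite scalerA.
Qed.

Lemma lin_indep_snoc k (e : 'I_k -> B) v :
  lin_indep e -> ~ lin_span e v -> lin_indep (snoc e v).
Proof.
move=> ie nv c; rewrite sum_snoc => c0.
have cm : c ord_max = 0.
  apply/eqP/negP => /negP cm; apply: nv; exists (fun i => - (c (lift ord_max i) / c ord_max)) => //.
  apply: (scalerI cm); rewrite scaler_sumr; move/eqP: c0; rewrite addrC addr_eq0 => /eqP ->.
  rewrite -sumrN; apply: eq_bigr => i _.
  by rewrite scalerA mulrN mulrCA divff // mulr1 scaleNr.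
move: c0; rewrite cm scale0r addr0 => /(ie (fun i => c (lift ord_max i))) ci i.
by case: (unliftP ord_max i) => [j ->|->]; [exact: ci|].
Qed.

Hypothesis infdim : forall n, exists e : 'I_n -> B, lin_indep e.

(** If [k] vectors spanned everything, the coefficient matrix of [k + 1] independent vectors would
    have a nonzero left kernel, hence yield a relation. *)
Lemma lin_indep_extend k (e : 'I_k -> B) : exists v, ~ lin_span e v.
Proof.
apply: contrapT => H; have {}H v : lin_span e v.
  by apply: contrapT => nv; apply: H; exists v.
have [b ib] := infdim k.+1.
have /choice[a aE] : forall i, exists a : 'I_k -> R, \sum_j a j *: e j = b i.
  by move=> i; have [a _ aE] := H (b i); exists a.
pose A : 'M[R]_(k.+1, k) := \matrix_(i, j) a i j.
have : kermx A != 0.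
  by rewrite kermx_eq0 /row_free; apply/eqP => rA; have := rank_leq_col A; rewrite rA ltnn.
case/rowV0Pn => w /sub_kermxP wA /negP; apply; apply/eqP/rowP => i; rewrite mxE.
apply: (ib (fun i => w ord0 i)).
under eq_bigr do rewrite -aE scaler_sumr.
rewrite exchange_big big1 //= => j _.
under eq_bigr do rewrite scalerA.
rewrite -scaler_suml; have := congr1 (fun C : 'rV_k => C ord0 j) wA.
by rewrite !mxE; under eq_bigr do rewrite mxE; move=> ->; rewrite scale0r.
Qed.

(** The width ranges over subspaces of dimension exactly [n]: dependent vectors are discarded first,
    then the rest is completed by infinite dimension. *)
Lemma lin_span_sub_dim m n (e : 'I_m -> B) : (m <= n)%N ->
  exists2 L, subspace_of_dim n L & lin_span e `<=` L.
Proof.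
have grow k k' (b : 'I_k -> B) : lin_indep b -> (k <= k')%N ->
    exists2 b' : 'I_k' -> B, lin_indep b' & lin_span b `<=` lin_span b'.
  move=> ib /subnKC <-; elim: (k' - k)%N => [|d [b' ib' bb']].
    by rewrite addn0; exists b.
  rewrite addnS; have [v nv] := lin_indep_extend b'.
  exists (snoc b' v); first exact: lin_indep_snoc.
  by apply: (subset_trans bb'); exact: lin_span_snoc.
suff: exists2 k, (k <= m)%N & exists2 b : 'I_k -> B, lin_indep b &
    forall i, lin_span b (e i).
  move=> [k km [b ib be]] mn; have [b' ib' bb'] := grow k n b ib (leq_trans km mn).
  exists (lin_span b'); first by exists b'.
  by move=> _ [c _ <-]; apply: lin_span_sum => i; exact/bb'/be.
elim: m e => [|m IH] e.
  by exists 0%N => //; exists (fun=> 0); [move=> c _ []|case].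
have [k km [b ib be]] := IH (fun i => e (lift ord_max i)).
have ext (P : B -> Prop) : (forall i, P (e (lift ord_max i))) -> P (e ord_max) -> forall i, P (e i).
  by move=> h1 h2 i; case: (unliftP ord_max i) => [j ->|->].
have [ev|nev] := pselect (lin_span b (e ord_max)).
  by exists k; [exact: leqW|exists b => //; exact: ext].
exists k.+1 => //; exists (snoc b (e ord_max)); first exact: lin_indep_snoc.
by apply: ext => [i|]; [exact/lin_span_snoc/be|exact: lin_span_snoc_last].
Qed.

Lemma kolmogorov_width_le m n (e : 'I_m -> B) (X : set B) (d : R) : (m <= n)%N ->
  (forall x, X x -> exists c : 'I_m -> R, `|x - \sum_i c i *: e i| <= d) ->
  (kolmogorov_width n X <= d%:E)%E.
Proof.
move=> mn Xd; have [L Ln eL] := lin_span_sub_dim e mn.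
apply: (@le_trans _ _ (ereal_sup [set ereal_inf [set `|x - u|%:E | u in L] | x in X])).
  by apply: ereal_inf_lbound; exists L.
apply: ge_ereal_sup => _ [x Xx <-]; have [c xc] := Xd x Xx.
apply: (@le_trans _ _ `|x - \sum_i c i *: e i|%:E); last by rewrite lee_fin.
by apply: ereal_inf_lbound; exists (\sum_i c i *: e i) => //; apply: eL; exists c.
Qed.

End Subspaces.

Lemma cvg_sumr (R : realType) (V : normedModType R) (T : Type) (F : set_system T)
    {FF : Filter F} (I : Type) (r : seq I) (f : I -> T -> V) (a : I -> V) :
  (forall i, f i @ F --> a i) ->
  (fun x => \sum_(i <- r) f i x) @ F --> \sum_(i <- r) a i.
Proof.
move=> fa; elim: r => [|i r IH].
  by rewrite big_nil; under eq_fun do rewrite big_nil; exact: cvg_cst.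
by rewrite big_cons; under eq_fun do rewrite big_cons; exact: cvgD.
Qed.

(** * Partitions of unity built from hat functions *)

Section PartitionOfUnity.
Variables (R : realType) (T : topologicalType) (J : finType) (D : T -> J -> R) (d : R).

(** [D t j] stands for the distance from [t] to the [j]-th node of a net, [d] for the radius of the
    supports. *)
Definition hat j t : R := Num.max 0 (d - D t j).

Definition pou j t : R := hat j t / \sum_i hat i t.

Lemma hat_ge0 j t : 0 <= hat j t. Proof. by rewrite /hat le_max lexx. Qed.

Lemma pou_ge0 j t : 0 <= pou j t.
Proof. by rewrite divr_ge0 ?hat_ge0 // sumr_ge0 // => i _; exact: hat_ge0. Qed.

Lemma sum_hat_gt0 t j : D t j < d -> 0 < \sum_i hat i t.
Proof.
move=> tj; rewrite (bigD1 j) //= ltr_wpDr //.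
  by rewrite sumr_ge0 // => i _; exact: hat_ge0.
by rewrite /hat lt_max subr_gt0 tj orbT.
Qed.

Lemma sum_pou t j : D t j < d -> \sum_i pou i t = 1.
Proof. by move=> tj; rewrite -mulr_suml divff // gt_eqF // (sum_hat_gt0 tj). Qed.

Lemma pou_neq0 i t : pou i t != 0 -> D t i < d.
Proof.
rewrite /pou mulf_eq0 negb_or => /andP[+ _]; rewrite /hat /Order.max.
by case: ifP => [|_]; rewrite ?eqxx // subr_gt0.
Qed.

Lemma pou_continuous t j i : (forall i, {for t, continuous (D^~ i)}) -> D t j < d ->
  {for t, continuous (pou i)}.
Proof.
move=> cD tj; have ch k : {for t, continuous (hat k)}.
  apply: continuous_max; first exact: cst_continuous.
  by apply: continuousB; [exact: cst_continuous|exact: cD].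
apply: continuousM => //; apply: continuousV; first by rewrite gt_eqF // (sum_hat_gt0 tj).
by apply: cvg_sumr => k; exact: ch.
Qed.

(** The combination is convex and only nodes closer than [d] carry weight, so the error bound is
    inherited. *)
Lemma pou_approx (V : normedModType R) t j (v : J -> V) (w : V) (e : R) :
  D t j < d -> (forall i, D t i < d -> `|w - v i| <= e) ->
  `|w - \sum_i pou i t *: v i| <= e.
Proof.
move=> tj wv.
have -> : w - \sum_i pou i t *: v i = \sum_i pou i t *: (w - v i).
  under [in RHS]eq_bigr do rewrite scalerBr.
  by rewrite sumrB -scaler_suml (sum_pou tj) scale1r.
rewrite (le_trans (ler_norm_sum _ _ _)) //.
rewrite -[leRHS]mul1r -(sum_pou tj) mulr_suml ler_sum // => i _.
rewrite normrZ ger0_norm ?pou_ge0 //.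
have [->|/pou_neq0 ti] := eqVneq (pou i t) 0; first by rewrite !mul0r.
by rewrite ler_wpM2l ?pou_ge0 // wv.
Qed.

End PartitionOfUnity.

(** * Lower bound for the Babenko width and comparison with the Kolmogorov width *)

Section WidthBounds.
Variables (R : realType) (B : completeNormedModType R).

(** [Pi] after the parametrization of the cube identifies points of two opposite faces; their [i]-th
    coefficients differ by [1], so a fiber has diameter at least [kappa]. *)
Lemma babenko_width_ge n N (e : 'I_N -> B) (X : set B) (kappa : R) : (n < N)%N ->
  (forall c : 'I_N -> R, (forall i, 0 <= c i <= 1) -> X (\sum_i c i *: e i)) ->
  (forall (c c' : 'I_N -> R) i, kappa * `|c i - c' i| <= `|\sum_i c i *: e i - \sum_i c' i *: e i|) ->
  (kappa%:E <= babenko_width n X)%E.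
Proof.
move=> nN Xe ke; apply: le_ereal_inf_tmp => _ [Pi /= cPi <-].
(* Clipping extends the parametrization continuously from the unit cube to all row vectors, as
   [fiber_opposite_faces] asks. *)
pose clip (a : R) : R := Num.min 1 (Num.max 0 a).
have clip01 a : 0 <= clip a <= 1.
  by rewrite /clip le_min ge_min lexx le_max lexx ler01.
have clipE a : 0 <= a <= 1 -> clip a = a.
  by rewrite /clip => /andP[a0 a1]; rewrite max_r // min_r.
pose g (x : 'rV[R]_N) := \sum_i clip (x ord0 i) *: e i.
have gX x : X (g x) by apply: Xe => i; exact: clip01.
have cg : continuous g.
  move=> x; apply: (@cvg_sumr _ _ _ (nbhs x)) => i; apply: cvgZr_tmp.
  apply: (@continuous_min _ _ (cst 1) _ x); first exact: cst_continuous.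
  apply: (@continuous_max _ _ (cst 0) _ x); first exact: cst_continuous.
  exact: coord_continuous.
have cG : continuous (Pi \o g).
  move=> x; have /subspace_continuousP/(_ (g x) (gX x)) := cPi.
  move=> cPx A /cPx WA; have {}WA : nbhs (g x) [set y | X y -> A (Pi y)] by exact: WA.
  apply: (@filterS _ (nbhs x)) (cg x _ WA) => z /=; apply; exact: gX.
have [x [y [i [cx cy xi yi Gxy]]]] := fiber_opposite_faces nN cG.
apply: (@le_trans _ _ (diam (X `&` [set z | Pi z = Pi (g x)]))); last first.
  by apply: ereal_sup_ubound; exists (g x).
apply: (@le_trans _ _ `|g x - g y|%:E); last first.
  by apply: ereal_sup_ubound; exists (g x) => //; exists (g y) => //; split.
rewrite lee_fin; have := ke (fun i => clip (x ord0 i)) (fun i => clip (y ord0 i)) i.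
by rewrite !clipE // xi yi sub0r normrN1 mulr1.
Qed.

(** Two functions in one fiber of [Pi] share their approximant, each being within [h / 2 + d] of
    it. *)
Lemma babenko_width_lt n (X : set B) (d : R) :
  (forall e : R, 0 < e -> exists J : finType, exists2 b : J -> B,
    (forall j, X (b j)) & forall x, X x -> exists j, `|x - b j| < e) ->
  (kolmogorov_width n X < d%:E)%E -> (babenko_width n X <= (2 * d)%:E)%E.
Proof.
move=> net kd; apply/lee_addgt0Pr => h h0.
have [_ [L [e ie ->] <-] supd] := ereal_inf_lt kd.
have h2 : 0 < h / 2 by rewrite divr_gt0.
have [J [b Xb netb]] := net _ h2.
have /choice[c bc] : forall j, exists c : 'I_n -> R, `|b j - \sum_i c i *: e i| < d.
  move=> j; have : (ereal_inf [set `|b j - u|%:E | u in lin_span e] < d%:E)%E.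
    by apply: le_lt_trans supd; apply: ereal_sup_ubound; exists (b j).
  by move=> /ereal_inf_lt[_ [_ [c _ <-] <-]]; rewrite lte_fin; exists c.
pose D (x : B) j := `|x - b j|.
(* The near-best coefficients [c j] of the net points are averaged with weights that are continuous
   on [X]. *)
pose Pi (x : B) : 'rV[R]_n := \row_i \sum_j pou D (h / 2) j x * c j i.
have cPi : {within X, continuous Pi}.
  apply/subspace_continuousP => x Xx; apply: cvg_within_filter.
  have [j xj] := netb x Xx.
  have cD k : {for x, continuous (D^~ k)}.
    by apply: continuous_comp; [apply: continuousB; [|exact: cst_continuous]|exact: norm_continuous].
  apply/cvgrPdist_le => eps eps0.
  suff : \forall t \near x, forall i, `|Pi x ord0 i - Pi t ord0 i| <= eps.
    apply: filterS => t Ht; apply: rV_norm_le; first exact: ltW.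
    by move=> i; rewrite mxE [X in _ + X]mxE; exact: Ht.
  apply: filter_forall => i.
  have : {for x, continuous (fun t => \sum_j pou D (h / 2) j t * c j i)}.
    apply: cvg_sumr => k; apply: cvgMr_tmp.
    by apply: (pou_continuous (j := j)).
  move=> /cvgrPdist_le/(_ _ eps0); apply: filterS => t.
  by rewrite /Pi !mxE.
apply: (@le_trans _ _ (ereal_sup [set diam (X `&` [set y | Pi y = Pi x]) | x in X])).
  by apply: ereal_inf_lbound; exists Pi.
apply: ge_ereal_sup => _ [x0 Xx0 <-].
apply: ge_ereal_sup => _ [x [Xx Pix] [y [Xy Piy] <-]].
have near z : X z -> `|z - \sum_i Pi z ord0 i *: e i| <= h / 2 + d.
  move=> Xz; have [j zj] := netb z Xz.
  have -> : \sum_i Pi z ord0 i *: e i = \sum_j pou D (h / 2) j z *: (\sum_i c j i *: e i).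
    under [in RHS]eq_bigr do rewrite scaler_sumr.
    rewrite exchange_big; apply: eq_bigr => i _ /=; rewrite mxE scaler_suml.
    by apply: eq_bigr => k _; rewrite scalerA.
  apply: (pou_approx (j := j)) => // k zk.
  rewrite -(subrKA (b k)) (le_trans (ler_normD _ _)) // lerD ?ltW //.
rewrite -EFinD lee_fin -(subrKA (\sum_i Pi x ord0 i *: e i)) (le_trans (ler_normD _ _)) //.
rewrite (_ : 2 * d + h = (h / 2 + d) + (h / 2 + d)); last by field.
rewrite lerD ?near // distrC.
rewrite /= in Pix Piy; rewrite Pix -Piy; exact: near.
Qed.

Lemma babenko_le_kolmogorov n (X : set B) :
  (forall e : R, 0 < e -> exists J : finType, exists2 b : J -> B,
    (forall j, X (b j)) & forall x, X x -> exists j, `|x - b j| < e) ->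
  (0 <= kolmogorov_width n X)%E ->
  (babenko_width n X <= 2%:E * kolmogorov_width n X)%E.
Proof.
move=> net; case E : (kolmogorov_width n X) => [k| |] // k0; last first.
  by rewrite mulr_infty gtr0_sg // mul1e leey.
rewrite -EFinM; apply/lee_addgt0Pr => h h0; rewrite -EFinD.
rewrite (_ : 2 * k + h = 2 * (k + h / 2)); last by field.
by apply: babenko_width_lt => //; rewrite E lte_fin ltrDl divr_gt0.
Qed.

End WidthBounds.

(** * Taylor estimates from partial derivatives *)

Lemma cvg_ext (T U : Type) (F : set_system T) (f g : T -> U) (y : set_system U) :
  f =1 g -> f @ F --> y -> g @ F --> y.
Proof. by move=> /(eq_cvg F y) ->. Qed.

Section Partials.
Variables (R : realType) (l : nat) (T : R).
Local Notation Om := (cube l T).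
Implicit Types (g : 'rV[R]_l -> R) (i : 'I_l) (t x y : 'rV[R]_l).

Definition upd t i (c : R) : 'rV[R]_l := t + (c - t ord0 i) *: delta_mx ord0 i.

Lemma updE t i c j : upd t i c ord0 j = if j == i then c else t ord0 j.
Proof.
rewrite !mxE eqxx /=; case: eqVneq => [->|_]; first by rewrite mulr1 addrC subrK.
by rewrite mulr0 addr0.
Qed.

Lemma upd_shift t i c h : upd t i c + h *: delta_mx ord0 i = upd t i (c + h).
Proof.
apply/rowP => j; rewrite updE mxE updE mxE mxE eqxx /=.
by case: eqVneq; rewrite ?mulr1 // mulr0 addr0.
Qed.

Lemma is_partial_filter t i :
  Filter (within [set h : R | Om (t + h *: delta_mx ord0 i)] 0^').
Proof. exact: within_filter. Qed.
#[local] Existing Instance is_partial_filter.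

Lemma is_partialB g g' i t d d' : is_partial Om g i t d -> is_partial Om g' i t d' ->
  is_partial Om (fun u => g u - g' u) i t (d - d').
Proof.
rewrite /is_partial => gd gd'; apply: cvg_ext (cvgB gd gd') => h /=.
by rewrite fctE /= -mulrBr !opprD addrACA.
Qed.

Lemma is_partial_sum (I : finType) (P : pred I) (G : I -> 'rV[R]_l -> R) i t (d : I -> R) :
  (forall a, P a -> is_partial Om (G a) i t (d a)) ->
  is_partial Om (fun u => \sum_(a | P a) G a u) i t (\sum_(a | P a) d a).
Proof.
move=> Gd; rewrite /is_partial [X in _ --> X]big_mkcond /=.
have : (\sum_a (if P a then h^-1 * (G a (t + h *: delta_mx ord0 i) - G a t) else 0))
   @[h --> within [set h | Om (t + h *: delta_mx ord0 i)] 0^'] --> \sum_a (if P a then d a else 0).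
  apply: cvg_sumr => a; case: ifP => Pa; [exact: Gd|exact: cvg_cst].
apply: cvg_ext => h /=.
rewrite -big_mkcond -mulr_sumr; congr (_ * _).
by rewrite sumrB.
Qed.

Lemma is_partialZ g i t d (c : R) : is_partial Om g i t d ->
  is_partial Om (fun u => c * g u) i t (c * d).
Proof.
rewrite /is_partial => gd.
by apply: cvg_ext (@cvgMl_tmp _ _ _ (is_partial_filter t i) _ c _ gd) => h /=; rewrite -mulrBr mulrCA.
Qed.

Lemma is_derive_partial g i t (d : R) :
  is_derive (0 : R) 1 (fun h => g (t + h *: delta_mx ord0 i)) d -> is_partial Om g i t d.
Proof.
move=> [dg <-]; rewrite /is_partial; apply: cvg_within_filter.
have := dg; rewrite /derivable /derive; apply: cvg_ext => h /=.
by rewrite addr0 scale0r addr0 [h *: 1]mulr1.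
Qed.

(** At an interior coordinate all small increments stay in the cube, so the relative derivative is
    an ordinary one. *)
Lemma partial_is_derive g i t (c d : R) : Om (upd t i c) -> 0 < c < T ->
  is_partial Om g i (upd t i c) d -> is_derive c 1 (fun a => g (upd t i a)) d.
Proof.
move=> tOm /andP[c0 cT] gd.
have H : (fun h : R => h^-1 *: (((fun a => g (upd t i a)) \o shift c) (h *: 1) - g (upd t i c)))
    @ 0^' --> d.
  move=> A /gd; rewrite /= => WA.
  have WA' : \forall h \near 0^', Om (upd t i c + h *: delta_mx ord0 i) ->
    A (h^-1 * (g (upd t i c + h *: delta_mx ord0 i) - g (upd t i c))) by exact: WA.
  have near0 : \forall h \near (0^' : set_system R), Om (upd t i c + h *: delta_mx ord0 i).
    apply: nbhs_dnbhs.
    exists (Num.min c (T - c)) => /=; first by rewrite lt_min c0 subr_gt0.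
    move=> h; rewrite /ball_ /= sub0r normrN lt_min => /andP[hc hT] j.
    rewrite upd_shift updE; case: eqVneq => [_|ji].
      move: hc hT; rewrite !ltr_norml => /andP[h1 h2] /andP[h3 h4].
      by apply/andP; split; lra.
    by have := tOm j; rewrite updE (negPf ji).
  have : \forall h \near (0^' : set_system R), A (h^-1 *:
     (((fun a => g (upd t i a)) \o shift c) (h *: 1) - g (upd t i c))).
    apply: filterS2 near0 WA' => h hO /(_ hO).
    by rewrite upd_shift /= [h *: 1]mulr1 [h + c]addrC.
  exact.
split; [by apply/cvg_ex; exists d|].
exact: (cvg_lim _ H).
Qed.

(** This covers the ends of the interval, where the mean value theorem asks for continuity but
    [partial_is_derive] is silent. *)
Lemma partial_continuous g i t (c d : R) : Om (upd t i c) -> 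
  is_partial Om g i (upd t i c) d ->
  forall e : R, 0 < e -> exists2 r : R, 0 < r &
    forall a, 0 <= a <= T -> `|c - a| < r -> `|g (upd t i c) - g (upd t i a)| < e.
Proof.
move=> tOm /cvgrPdist_lt/(_ 1 ltr01) H e e0.
have : \forall h \near (0 : R), h != 0 -> Om (upd t i c + h *: delta_mx ord0 i) ->
  `|d - h^-1 * (g (upd t i c + h *: delta_mx ord0 i) - g (upd t i c))| < 1 by exact: H.
(* Within [r] the difference quotient is at most [|d| + 1] in absolute value; the second radius then
   keeps the increment below [e]. *)
move=> /nbhs_ballP[r /= r0 rH]; exists (Num.min r (e / (`|d| + 1))).
  by rewrite lt_min r0 divr_gt0 // ltr_wpDl.
move=> a a0T; rewrite lt_min => /andP[ar ae].
have [->|ac] := eqVneq a c; first by rewrite subrr normr0.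
have /= := rH (a - c); rewrite -ball_normE /= sub0r opprB => /(_ ar).
rewrite subr_eq0 => /(_ ac).
rewrite upd_shift (addrC c) subrK => H1.
have : Om (upd t i a).
  move=> j; rewrite updE; case: eqVneq => // ji.
  by have := tOm j; rewrite updE (negPf ji).
move=> /H1; set q := g _ - g _ => Hq; rewrite distrC -/q.
have -> : q = (a - c) * ((a - c)^-1 * q) by rewrite mulrA divff ?mul1r // subr_eq0.
have : `|(a - c)^-1 * q| <= `|d| + 1.
  rewrite -(subrK d ((a - c)^-1 * q)) (le_trans (ler_normD _ _)) // addrC lerD2l.
  by rewrite distrC ltW.
move=> qd; rewrite normrM (le_lt_trans (ler_wpM2l _ qd)) // -ltr_pdivlMr ?ltr_wpDl //.
by rewrite distrC.
Qed.

End Partials.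

(** * Taylor polynomials and their error *)

Section Taylor.
Variables (R : realType) (l : nat) (T : R).
Local Notation Om := (cube l T).
Implicit Types (g : 'rV[R]_l -> R) (i : 'I_l) (t x y : 'rV[R]_l) (k : {ffun 'I_l -> nat}).

Lemma segment_increment g i t (dg : R -> R) (a b K : R) :
  Om t -> 0 <= a <= T -> 0 <= b <= T ->
  (forall c, Num.min a b <= c <= Num.max a b -> is_partial Om g i (upd t i c) (dg c)) ->
  (forall c, Num.min a b <= c <= Num.max a b -> `|dg c| <= K) ->
  `|g (upd t i b) - g (upd t i a)| <= K * `|b - a|.
Proof.
wlog ab : a b / a <= b => [H|].
  have /orP[ab|ba] := le_total a b; first exact: H.
  move=> tO aT bT; rewrite (minC a b) (maxC a b) (distrC (g _)) (distrC b a) => gd dK; exact: H.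
have [->|nab] := eqVneq a b; first by rewrite !subrr normr0 mulr0.
move=> tOm /andP[a0 aT] /andP[b0 bT]; rewrite min_l // max_r // => gd dK.
have lab : a < b by rewrite lt_neqAle nab.
have updOm c : a <= c <= b -> Om (upd t i c).
  move=> /andP[ac cb] j; rewrite updE; case: eqVneq => [_|_]; last exact: tOm.
  by rewrite (le_trans a0 ac) (le_trans cb bT).
have [||c cab ->] := @MVT R (fun c => g (upd t i c)) dg a b lab.
- move=> c; rewrite in_itv /= => /andP[ac cb].
  apply: (@partial_is_derive _ _ T).
  + by apply: updOm; rewrite !ltW.
  + by rewrite (le_lt_trans a0 ac) (lt_le_trans cb bT).
  + by apply: gd; rewrite !ltW.
- apply/subspace_continuousP => c; rewrite /= in_itv /= => cab.
  apply/cvgrPdist_lt => e e0.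
  have [r r0 rH] := partial_continuous (updOm _ cab) (gd _ cab) e0.
  apply/nbhs_ballP; exists r => // u; rewrite -ball_normE /= => cu; rewrite in_itv /= => /andP[au ub].
  by apply: rH => //; rewrite (le_trans a0 au) (le_trans ub bT).
rewrite normrM ler_wpM2r // dK //; move: cab; rewrite in_itv /= => /andP[/ltW -> /ltW ->].
by [].
Qed.

Definition mono x (a : {ffun 'I_l -> nat}) t : R :=
  \prod_i ((t ord0 i - x ord0 i) ^+ a i / (a i)`!%:R).

Lemma mono_shift x (a : {ffun 'I_l -> nat}) t i h : mono x a (t + h *: delta_mx ord0 i) =
  (\prod_(j | j != i) ((t ord0 j - x ord0 j) ^+ a j / (a j)`!%:R)) *
  ((h + (t ord0 i - x ord0 i)) ^+ a i / (a i)`!%:R).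
Proof.
rewrite /mono (bigD1 i) //= mulrC; congr (_ * _).
  by apply: eq_bigr => j ji; rewrite !mxE eqxx (negPf ji) mulr0 addr0.
by rewrite !mxE !eqxx mulr1 addrAC addrC.
Qed.

Lemma mono_partial0 x (a : {ffun 'I_l -> nat}) t i : a i = 0%N -> is_partial Om (mono x a) i t 0.
Proof.
move=> ai; apply: is_derive_partial.
under eq_fun do rewrite mono_shift ai expr0.
exact: is_derive_cst.
Qed.

Lemma mono_partial x (b : {ffun 'I_l -> nat}) t i : is_partial Om (mono x (mincr b i)) i t (mono x b t).
Proof.
apply: is_derive_partial.
under eq_fun do rewrite mono_shift.
set C := \prod_(j | _) _; set z := t ord0 i - x ord0 i.
rewrite !ffunE eqxx addn1.
have -> : (fun h : R => C * ((h + z) ^+ (b i).+1 / (b i).+1`!%:R)) =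
    (C / (b i).+1`!%:R) \*: (((id : R -> R) + cst z) ^+ (b i).+1).
  by apply/funext => h /=; rewrite exprfctE [RHS]mulrAC -mulrA.
have dz : is_derive (0 : R) 1 ((id : R -> R) + cst z) (1 : R).
  by apply: is_derive_eq; rewrite addr0.
apply: (is_derive_eq (is_deriveZ (C / (b i).+1`!%:R) (is_deriveX (b i).+1 dz))).
rewrite /mono (bigD1 i) //= -/z.
have -> : ((id : R -> R) + cst z) 0 = z by rewrite fctE add0r.
rewrite [RHS]mulrC (_ : \prod_(j | _) _ = C); last first.
  by apply: eq_bigr => j ji; rewrite ffunE (negPf ji) addn0.
rewrite [_%:A]mulr1 /GRing.scale /= factS natrM; field.
by rewrite nat1r !pnatr_eq0 -lt0n fact_gt0.
Qed.

Section Polynomial.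
Variables (D : {ffun 'I_l -> nat} -> 'rV[R]_l -> R) (S : nat).

Definition mindex (a : {ffun 'I_l -> 'I_S}) : {ffun 'I_l -> nat} := [ffun i => nat_of_ord (a i)].

Definition madd k (a : {ffun 'I_l -> nat}) : {ffun 'I_l -> nat} := [ffun i => (k i + a i)%N].

(** Bounding the entries by [S] makes the multi-indices a finite type; for [p <= S] the degree
    condition already implies this bound. *)
Definition taylor p x k t : R :=
  \sum_(a : {ffun 'I_l -> 'I_S} | (mdegree (mindex a) < p)%N) D (madd k (mindex a)) x * mono x (mindex a) t.

Lemma mdegree_incr k i : mdegree (mincr k i) = (mdegree k).+1.
Proof.
rewrite /mdegree (bigD1 i) // [in RHS](bigD1 i) //= ffunE eqxx addn1 addSn; congr (_ + _).+1.
by apply: eq_bigr => j ji; rewrite ffunE (negPf ji) addn0.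
Qed.

Lemma leq_mdegree k i : (k i <= mdegree k)%N.
Proof. by rewrite /mdegree (bigD1 i) //= leq_addr. Qed.

Lemma taylor_at p x k : (0 < p <= S)%N -> taylor p x k x = D k x.
Proof.
move=> /andP[p0 pS]; have S0 : (0 < S)%N by exact: leq_trans pS.
pose z : {ffun 'I_l -> 'I_S} := [ffun=> Ordinal S0].
have z0 : mindex z = [ffun=> 0%N] by apply/ffunP => i; rewrite !ffunE.
rewrite /taylor (bigD1 z) /=; last first.
  by rewrite /mdegree big1 // => i _; rewrite !ffunE.
rewrite big1 => [|a /andP[_ az]].
  have e1 : madd k [ffun=> 0%N] = k by apply/ffunP => i; rewrite !ffunE addn0.
  have e2 : mono x [ffun=> 0%N] x = 1.
    by rewrite /mono big1 // => i _; rewrite ffunE expr0 divr1.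
  by rewrite addr0 z0 e1 e2 mulr1.
have [i ai] : exists i, nat_of_ord (a i) != 0%N.
  apply/existsP; rewrite -[X in is_true X]negbK negb_exists; apply/negP => /forallP H.
  move/eqP: az; apply; apply/ffunP => i; rewrite ffunE; apply: val_inj => /=.
  by apply/eqP; have := H i; rewrite negbK.
by rewrite /mono (bigD1 i) //= ffunE subrr expr0n (negPf ai) !mul0r mulr0.
Qed.

Lemma taylor1 x k t : (0 < S)%N -> taylor 1 x k t = D k x.
Proof.
move=> S0; pose z : {ffun 'I_l -> 'I_S} := [ffun=> Ordinal S0].
have z0 : mindex z = [ffun=> 0%N] by apply/ffunP => i; rewrite !ffunE.
rewrite /taylor (big_pred1 z) => [|a] /=; last first.
  rewrite ltnS leqn0 /mdegree sum_nat_eq0; apply/forallP/eqP => [a0|-> i]; last first.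
    by rewrite z0 ffunE.
  by apply/ffunP => i; apply: ord_inj; have := a0 i; rewrite !ffunE => /eqP.
rewrite z0 (_ : madd k _ = k); last by apply/ffunP => i; rewrite !ffunE addn0.
by rewrite /mono big1 ?mulr1 // => i _; rewrite ffunE expr0 divr1.
Qed.

(** Differentiation kills the monomials free of coordinate [i] and lowers the others by one, which
    yields the polynomial of the derivative. *)
Lemma taylor_partial p x k t i : (p < S)%N ->
  is_partial Om (taylor p.+1 x k) i t (taylor p x (mincr k i) t).
Proof.
(* [inc] and [dec] match the indices of degree below [p] with those of degree at most [p] having a
   positive [i]-th entry; [p < S] keeps [insubd] away from its default there. *)
move=> pS; pose inc (b : {ffun 'I_l -> 'I_S}) : {ffun 'I_l -> 'I_S} :=
  [ffun j => if j == i then insubd (b j) (b j).+1 else b j].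
pose dec (b : {ffun 'I_l -> 'I_S}) : {ffun 'I_l -> 'I_S} :=
  [ffun j => if j == i then insubd (b j) (b j).-1 else b j].
have decE (b : {ffun 'I_l -> 'I_S}) j : nat_of_ord (dec b j) = if j == i then (b j).-1 else b j.
  rewrite ffunE; case: eqP => // _; rewrite -[LHS]/(val _) val_insubd (leq_ltn_trans (leq_pred _)) //.
have incE (b : {ffun 'I_l -> 'I_S}) j : ((b i).+1 < S)%N -> nat_of_ord (inc b j) = if j == i then (b j).+1 else b j.
  by move=> bS; rewrite ffunE; case: eqP => // ->; rewrite -[LHS]/(val _) val_insubd bS.
clearbody dec inc.
have decK (b : {ffun 'I_l -> 'I_S}) : (0 < nat_of_ord (b i))%N -> mincr (mindex (dec b)) i = mindex b.
  move=> b0; apply/ffunP => j; rewrite !ffunE decE.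
  by case: eqVneq => [->|_]; rewrite ?addn0 // addn1 prednK.
have -> : taylor p x (mincr k i) t =
    \sum_(a : {ffun 'I_l -> 'I_S} | (mdegree (mindex a) < p.+1)%N) D (madd k (mindex a)) x *
      (if nat_of_ord (a i) == 0%N then 0 else mono x (mindex (dec a)) t).
  rewrite [RHS](bigID (fun a : {ffun 'I_l -> 'I_S} => nat_of_ord (a i) == 0%N)) /= big1 ?add0r; last first.
    by move=> a /andP[_ ->]; rewrite mulr0.
  rewrite [LHS](reindex_onto dec inc) /=; last first.
    move=> b bp; apply/ffunP => j; apply: ord_inj; rewrite decE incE.
      by case: eqVneq => [->|].
    have := leq_mdegree (mindex b) i; rewrite ffunE => /leq_ltn_trans/(_ bp) bp'.
    by rewrite (leq_ltn_trans bp').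
  apply: eq_big => [a|a /andP[ap /eqP ia]].
    have [a0|a0] := posnP (nat_of_ord (a i)).
      rewrite andbF; apply/negP => /andP[ap /eqP/ffunP/(_ i)/(congr1 (@nat_of_ord S))].
      rewrite incE decE eqxx a0 //=.
      by rewrite (leq_trans _ pS) // ltnS (leq_trans _ ap).
    rewrite andbT -[in RHS](decK _ a0) mdegree_incr ltnS.
    rewrite (_ : inc (dec a) == a); first by rewrite andbT.
    apply/eqP/ffunP => j; apply: ord_inj; rewrite incE decE ?eqxx ?prednK ?ltn_ord //.
    by case: eqVneq => [->|] //; rewrite prednK.
  have a0 : (0 < nat_of_ord (a i))%N.
    rewrite lt0n; apply/eqP => a0; move/ffunP/(_ i)/(congr1 (@nat_of_ord S)): ia; rewrite incE decE eqxx a0 //=.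
    by rewrite (leq_trans _ pS) // ltnS (leq_trans _ ap).
  rewrite gtn_eqF //; congr (D _ _ * _); rewrite -(decK _ a0).
  by apply/ffunP => j; rewrite !ffunE -addnA [(_ + (j == i))%N]addnC.
apply: is_partial_sum => a ap; apply: is_partialZ; case: posnP => a0.
  by apply: mono_partial0; rewrite ffunE.
by rewrite -(decK _ a0); exact: mono_partial.
Qed.

Definition between x y (u : 'rV[R]_l) :=
  forall i, Num.min (x ord0 i) (y ord0 i) <= u ord0 i <= Num.max (x ord0 i) (y ord0 i).

Lemma betweenr x y : between x y y.
Proof. by move=> i; rewrite ge_min le_max lexx !orbT. Qed.

Lemma between_trans x y (u v : 'rV[R]_l) : between x y u -> between x u v -> between x y v.
Proof.
move=> xyu xuv i; have := xyu i; have := xuv i.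
rewrite !ge_min !le_max => /andP[/orP[h1|h1] /orP[h2|h2]] /andP[/orP[h3|h3] /orP[h4|h4]];
  by apply/andP; split; apply/orP; lra.
Qed.

Lemma between_cube x y u : Om x -> Om y -> between x y u -> Om u.
Proof.
move=> xO yO xyu i; have := xyu i; have := xO i; have := yO i.
by rewrite !ge_min !le_max => /andP[? ?] /andP[? ?] /andP[/orP[h1|h1] /orP[h2|h2]];
  apply/andP; split; lra.
Qed.

Lemma between_dist x y u i : between x y u -> `|u ord0 i - x ord0 i| <= `|y ord0 i - x ord0 i|.
Proof.
move=> /(_ i); rewrite /Order.min /Order.max; case: ltP => xy /andP[h1 h2].
  by rewrite !ger0_norm ?subr_ge0 ?lerD2r // ltW.
by rewrite !ler0_norm ?subr_le0 ?lerN2 ?lerD2r.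
Qed.

(* Move from [x] to [y] one coordinate at a time; each step is controlled by the
   mean value theorem and the estimate at order [p - 1] for a partial derivative. *)
Lemma taylor_error p x k y (h A : R) : (p <= S)%N -> Om x -> Om y ->
  (forall i, `|y ord0 i - x ord0 i| <= h) ->
  (forall u k' i, between x y u -> (mdegree k <= mdegree k' < mdegree k + p)%N ->
     is_partial Om (D k') i u (D (mincr k' i) u)) ->
  (forall u k', between x y u -> mdegree k' = (mdegree k + p)%N -> `|D k' u| <= A) ->
  `|D k y - taylor p x k y| <= (l%:R * h) ^+ p * A.
Proof.
move=> + xO; elim: p k y => [|p IH] k y pS yO yx parts bnd.
  rewrite /taylor big_pred0 // subr0 expr0 mul1r; apply: bnd; rewrite ?addn0 //.
  exact: betweenr.
pose E u := D k u - taylor p.+1 x k u.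
pose z m : 'rV[R]_l := \row_j if (j < m)%N then y ord0 j else x ord0 j.
have zy : z l = y by apply/rowP => j; rewrite mxE ltn_ord.
have z0 : z 0%N = x by apply/rowP => j; rewrite mxE.
have updz (m : 'I_l) : upd (z m) m (y ord0 m) = z m.+1 /\ upd (z m) m (x ord0 m) = z m.
  split; apply/rowP => j; rewrite updE !mxE; case: eqVneq => [->|jm]; rewrite ?leqnn ?ltnn //.
  by rewrite ltnS (leq_eqVlt j) (val_eqE j) (negPf jm).
have zbt m : between x y (z m).
  by move=> j; rewrite mxE; case: ifP; rewrite ge_min le_max lexx ?orbT.
have zO m : Om (z m) by exact: between_cube (zbt m).
have E0 : E (z 0%N) = 0 by rewrite /E z0 taylor_at ?subrr.
have step (m : 'I_l) : `|E (z m.+1) - E (z m)| <= (l%:R * h) ^+ p * A * h.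
  have [<- zm] := updz m; rewrite -[X in _ - E X]zm.
  have lA0 : 0 <= (l%:R * h) ^+ p * A.
    have h0 : 0 <= h by rewrite (le_trans _ (yx m)).
    rewrite mulr_ge0 ?exprn_ge0 ?mulr_ge0 //.
    (* A derivative of the top order, taken wholly in direction [m]; being bounded by [A], it shows
       [0 <= A]. *)
    pose kk : {ffun 'I_l -> nat} := [ffun j => (k j + (j == m) * p.+1)%N].
    rewrite (le_trans (normr_ge0 (D kk y))) // bnd //; first exact: betweenr.
    rewrite /mdegree; under eq_bigr do rewrite ffunE.
    rewrite big_split /=; congr (_ + _)%N.
    by rewrite (bigD1 m) //= eqxx mul1n big1 ?addn0 // => j /negPf ->.
  apply: (@le_trans _ _ ((l%:R * h) ^+ p * A * `|y ord0 m - x ord0 m|)); last by rewrite ler_wpM2l.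
  have ubt c : Num.min (x ord0 m) (y ord0 m) <= c <= Num.max (x ord0 m) (y ord0 m) ->
      between x y (upd (z m) m c).
    by move=> cxy j; rewrite updE; case: eqVneq => [->|_] //; exact: zbt.
  apply: (@segment_increment _ _ _ (fun c => D (mincr k m) (upd (z m) m c) -
    taylor p x (mincr k m) (upd (z m) m c))) => // c cxy.
    apply: is_partialB; last exact: taylor_partial.
    apply: parts; first exact: ubt.
    by rewrite leqnn addnS ltnS leq_addr.
  have cbt := ubt c cxy; apply: IH.
  - exact: ltnW.
  - exact: between_cube cbt.
  - by move=> i; exact: le_trans (between_dist i cbt) (yx i).
  - move=> u k' i ub; rewrite mdegree_incr addSnnS => /andP[k1 k2]; apply: parts.
      exact: between_trans cbt ub.
    by rewrite k2 (ltnW k1).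
  - move=> u k' ub; rewrite mdegree_incr addSnnS; apply: bnd.
    exact: between_trans cbt ub.
have -> : D k y - taylor p.+1 x k y = \sum_(m < l) (E (z m.+1) - E (z m)).
  rewrite -(big_mkord xpredT (fun m => E (z m.+1) - E (z m))) telescope_sumr // E0 subr0.
  by rewrite /E zy.
rewrite (le_trans (ler_norm_sum _ _ _)) // (le_trans (ler_sum _ (fun m _ => step m))) //.
by rewrite sumr_const card_ord -mulr_natl exprS; rewrite le_eqVlt; apply/orP; left; apply/eqP; ring.
Qed.

End Polynomial.
End Taylor.

(** * Bump functions and the lower bound *)

Section Bump1.
Variables (R : realType) (S : nat).

(** The roots [0] and [1] have order [S + 1], so all derivatives up to order [S] vanish there and
    match the extension by zero. *)
Definition bpoly : {poly R} := ('X * (1 - 'X)) ^+ S.+1.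

Lemma derivn_root (f q : {poly R}) (c : R) n k :
  f = ('X - c%:P) ^+ n.+1 * q -> (k <= n)%N -> (f^`(k)).[c] = 0.
Proof.
elim: k f q n => [|k IH] f q n ->.
  by move=> _; rewrite derivn0 exprS !hornerE subrr !mul0r.
case: n => // n kn; rewrite derivSn.
apply: (IH _ ((n.+2)%:R *: q + ('X - c%:P) * q^`()) n) => //.
rewrite derivM deriv_exp derivXsubC mul1r /= mulrDr [X in _ = _ + X]mulrA -exprSr.
by rewrite -scalerAr scaler_nat mulrnAl.
Qed.

Lemma bpoly_derivn01 k : (k <= S)%N -> ((bpoly^`(k)).[0] = 0) * ((bpoly^`(k)).[1] = 0).
Proof.
move=> kS; split.
  apply: (@derivn_root _ ((1 - 'X) ^+ S.+1) 0 S) => //.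
  by rewrite /bpoly exprMn subr0.
apply: (@derivn_root _ ((- 'X) ^+ S.+1) 1 S) => //.
rewrite /bpoly !exprMn mulrC -exprMn -[in RHS]exprMn; congr (_ ^+ _).
by rewrite -[X in X * _]opprB mulNr mulrN.
Qed.

Definition bumpf k (x : R) : R := if 0 <= x <= 1 then (bpoly^`(k)).[x] else 0.

Lemma bump_out k x : (k <= S)%N -> (x <= 0) || (1 <= x) -> bumpf k x = 0.
Proof.
move=> kS; rewrite /bumpf; case: ifP => // /andP[x0 x1] /orP[x0'|x1'].
  by rewrite (_ : x = 0) ?bpoly_derivn01 //; apply/eqP; rewrite eq_le x0 x0'.
by rewrite (_ : x = 1) ?bpoly_derivn01 //; apply/eqP; rewrite eq_le x1 x1'.
Qed.

Lemma is_derive_bump k (x : R) : (k < S)%N -> is_derive x (1 : R) (bumpf k) (bumpf k.+1 x).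
Proof.
move=> kS; pose f := bpoly^`(k).
have df (u : R) : is_derive u 1 (horner f) ((bpoly^`(k.+1)).[u]).
  apply: DeriveDef; first exact: derivable_horner.
  by rewrite derivnS derivE derive1E.
have [xI|] := boolP ((x \in `]0, 1[%R)).
  move: (xI); rewrite in_itv /= => /andP[x0 x1].
  have -> : bumpf k.+1 x = (bpoly^`(k.+1)).[x] by rewrite /bumpf !ltW.
  apply: near_eq_is_derive (df x).
  have : \forall u \near x, u \in `]0, 1[%R by exact: near_in_itvoo.
  apply: filterS => u; rewrite in_itv /= => /andP[u0 u1].
  by rewrite /bumpf !ltW.
rewrite in_itv /= negb_and -!leNgt => xout; rewrite [bumpf k.+1 x]bump_out //.
have bx : bumpf k x = 0 by rewrite bump_out // ltnW.
have H : (fun h : R => h^-1 *: ((bumpf k \o shift x) (h *: 1) - bumpf k x)) @ 0^' --> (0 : R).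
  rewrite bx; apply/cvgrPdist_le => e e0.
  (* At [0] and [1] the quotient is dominated by that of the polynomial, whose derivative of order
     [k + 1] vanishes because [k < S]. *)
  have [x01|x01] := boolP (0 <= x <= 1).
    have fx : f.[x] = 0 by rewrite -bx /bumpf x01.
    have dfx : (bpoly^`(k.+1)).[x] = 0.
      by move: (@bump_out k.+1 x kS xout); rewrite /bumpf x01.
    have H0 (d : R) : 'D_1 (horner f) x = d ->
        (fun h : R => h^-1 *: ((horner f \o shift x) (h *: 1) - f.[x])) @ 0^' --> d.
      by move=> <-; have [+ _] := df x.
    have [_] := df x; rewrite dfx => /H0.
    move=> /cvgrPdist_le/(_ _ e0); apply: filterS => h; rewrite !sub0r !normrN /= fx !subr0.
    apply: le_trans; rewrite ![`|h^-1 *: _|]normrM ler_wpM2l // /bumpf; case: ifP => //.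
    by rewrite normr0.
  have : \forall u \near x, ~~ (0 <= u <= 1).
    move: x01; rewrite negb_and -!ltNge => /orP[x0|x1].
      have : \forall u \near x, u < 0 by exact: lt_nbhsl.
      by apply: filterS => u; rewrite ltNge => /negbTE ->.
    have : \forall u \near x, 1 < u by exact: lt_nbhsr.
    by apply: filterS => u; rewrite ltNge => /negbTE ->; rewrite andbF.
  move=> /nbhs_ballP[r /= r0 rH]; apply: filterS (dnbhs0_lt r0) => h hr.
  have /negbTE hx : ~~ (0 <= h *: 1 + x <= 1).
    by apply: rH; rewrite -ball_normE /= [h *: 1]mulr1 opprD addrCA subrr addr0 normrN.
  by rewrite /= /bumpf hx subrr scaler0 subr0 normr0 ltW.
split; [by apply/cvg_ex; exists 0|exact: (cvg_lim _ H)].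
Qed.

(** On [[0, 1]] a polynomial is bounded by the sum of the absolute values of its coefficients; the
    added [1] makes the constant at least [1]. *)
Definition bumpC : R := 1 + \sum_(k < S.+1) \sum_(i < size (bpoly^`(k))) `|(bpoly^`(k))`_i|.

Lemma bumpC_ge1 : 1 <= bumpC.
Proof. by rewrite lerDl sumr_ge0 // => k _; rewrite sumr_ge0. Qed.

Lemma bump_le k x : (k <= S)%N -> `|bumpf k x| <= bumpC.
Proof.
move=> kS; rewrite /bumpf; case: ifP => [/andP[x0 x1]|_]; last first.
  by rewrite normr0 (le_trans ler01) // bumpC_ge1.
rewrite horner_coef (le_trans (ler_norm_sum _ _ _)) // /bumpC ler_wpDl //.
rewrite (bigD1 (Ordinal (kS : (k < S.+1)%N))) //= ler_wpDr //.
  by rewrite sumr_ge0 // => j _; rewrite sumr_ge0.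
apply: ler_sum => i _; rewrite normrM ler_piMr // normrX ger0_norm // exprn_ile1 //.
Qed.

(** Supports of distinct integer translates have disjoint interiors, so at most one term is
    nonzero. *)
Lemma sum_bump_le k m x : (k <= S)%N -> \sum_(j < m) `|bumpf k (x - j%:R)| <= bumpC.
Proof.
move=> kS; have [/existsP[j bj]|] := boolP [exists j : 'I_m, bumpf k (x - j%:R) != 0].
  have in01 (i : 'I_m) : bumpf k (x - i%:R) != 0 -> 0 < x - i%:R < 1.
    by apply: contraNT; rewrite negb_and -!leNgt => /(bump_out kS) ->.
  rewrite (bigD1 j) //= big1 ?addr0 ?bump_le // => i ij; apply/eqP.
  rewrite normr_eq0; apply: contraNT ij => /in01 /andP[i0 i1].
  have /andP[j0 j1] := in01 j bj.
  have : (i < j.+1)%N by rewrite -(ltr_nat R) -natr1; lra.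
  have : (j < i.+1)%N by rewrite -(ltr_nat R) -natr1; lra.
  by rewrite !ltnS => ji ij; rewrite -val_eqE eqn_leq /= ij ji.
rewrite negb_exists => /forallP H; rewrite big1 ?(le_trans ler01) ?bumpC_ge1 // => i _.
by apply/eqP; rewrite normr_eq0 -[_ == _]negbK H.
Qed.

Lemma bump_half : bumpf 0 2^-1 = 4^-1 ^+ S.+1.
Proof.
rewrite /bumpf invr_ge0 invf_le1 // ler0n ler1n /= /bpoly horner_exp !hornerE.
by congr (_ ^+ _); field.
Qed.

End Bump1.

Lemma cvg_prodr (R : realType) (T : Type) (F : set_system T) {FF : Filter F}
    (I : Type) (r : seq I) (f : I -> T -> R) (a : I -> R) :
  (forall i, f i @ F --> a i) ->
  (fun x => \prod_(i <- r) f i x) @ F --> \prod_(i <- r) a i.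
Proof.
move=> fa; elim: r => [|i r IH].
  by rewrite big_nil; under eq_fun do rewrite big_nil; exact: cvg_cst.
by rewrite big_cons; under eq_fun do rewrite big_cons; exact: cvgM.
Qed.

Lemma cubeC_sumE (R : realType) l (T : R) (I : Type) (r : seq I) (c : I -> R)
    (f : I -> cubeC l T) t : (\sum_(i <- r) c i *: f i) t = \sum_(i <- r) c i * f i t.
Proof. by rewrite (big_morph (fun g : cubeC l T => g t) (id1 := 0) (op1 := +%R)). Qed.

Lemma val_coord_continuous (R : realType) l (T : R) (t : cube l T) i :
  (fun u : cube l T => val u ord0 i) @ t --> val t ord0 i.
Proof.
apply: (@cvg_comp _ _ _ (val : cube l T -> 'rV[R]_l) (fun u => u ord0 i) _ (nbhs (val t))).
  exact: (@initial_continuous _ _ (val : cube l T -> 'rV[R]_l) t).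
exact: coord_continuous.
Qed.

(** * Grids of bumps in the cube *)

Section BumpFamily.
Variables (R : realType) (l : nat) (T : R) (S m : nat).
Hypotheses (T0 : 0 < T) (S0 : (0 < S)%N) (m0 : (0 < m)%N).
Implicit Types (c : {ffun 'I_l -> 'I_m}) (k : {ffun 'I_l -> nat}).

Let rate : R := m%:R / T.

Let rate0 : 0 < rate. Proof. by rewrite divr_gt0 // ltr0n. Qed.

(** Partial derivative of multi-index [k] of the product bump on the grid cell [c] of side [T / m];
    each differentiation brings out a factor [rate]. *)
Definition cellD c k (t : 'rV[R]_l) : R :=
  \prod_i (rate ^+ k i * bumpf S (k i) (rate * t ord0 i - (c i)%:R)).

Lemma cellD_partial c k i t : (k i < S)%N ->
  is_partial (cube l T) (cellD c k) i t (cellD c (mincr k i) t).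
Proof.
move=> kS; apply: is_derive_partial.
pose C := \prod_(j | j != i) (rate ^+ k j * bumpf S (k j) (rate * t ord0 j - (c j)%:R)).
pose z := rate * t ord0 i - (c i)%:R.
pose g : R -> R := (rate \*: (id : R -> R)) + cst z.
have -> : (fun h : R => cellD c k (t + h *: delta_mx ord0 i)) =
    (C * rate ^+ k i) \*: (bumpf S (k i) \o g).
  apply/funext => h /=; rewrite /cellD (bigD1 i) //= mulrC -[RHS]mulrA; congr (_ * (_ * _)).
    by apply: eq_bigr => j ji; rewrite !mxE eqxx (negPf ji) mulr0 addr0.
  by rewrite !mxE !eqxx mulr1 mulrDr /g fctE /z addrCA addrA.
have dg : is_derive (0 : R) 1 g rate by apply: is_derive_eq; rewrite addr0 [_ *: _]mulr1.
have g0 : g 0 = z by rewrite /g !fctE /= /GRing.scale /= mulr0 add0r.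
have db := is_derive_bump (S := S) (g 0) kS.
apply: (is_derive_eq (is_deriveZ (C * rate ^+ k i) (is_derive1_comp db dg))).
rewrite g0 /cellD (bigD1 i) //= ffunE eqxx addn1 [RHS]mulrC.
rewrite (_ : \prod_(j | j != i) _ = C); last first.
  by apply: eq_bigr => j ji; rewrite ffunE (negPf ji) addn0.
by rewrite /GRing.scale /= exprS -/z; ring.
Qed.

(** The sum over cells factors into a product over the coordinates of one-dimensional sums. *)
Lemma sum_cellD_le k t : (mdegree k <= S)%N ->
  \sum_c `|cellD c k t| <= rate ^+ mdegree k * bumpC R S ^+ l.
Proof.
move=> kS; under eq_bigr do rewrite /cellD normr_prod.
rewrite -(bigA_distr_bigA (fun i (j : 'I_m) => `|rate ^+ k i * bumpf S (k i) (rate * t ord0 i - j%:R)|)).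
rewrite /mdegree -prodrXr -[X in _ ^+ X]card_ord -prodr_const -big_split /=.
apply: ler_prod => i _; rewrite sumr_ge0 //=.
under eq_bigr do rewrite normrM ger0_norm ?exprn_ge0 ?(ltW rate0) //.
rewrite -mulr_sumr ler_wpM2l ?exprn_ge0 ?(ltW rate0) // sum_bump_le //.
exact: leq_trans (leq_mdegree _ _) kS.
Qed.

Lemma cellD_cts c : (fun t : cube l T => cellD c [ffun=> 0%N] (val t)) \in @ctsfun R l T.
Proof.
apply/ctsfunP => t; have Ft : Filter (nbhs t) by exact: nbhs_filter.
apply: (@cvg_prodr _ _ (nbhs t) Ft) => i; apply: (@cvgMl_tmp _ _ (nbhs t) Ft).
have cb : continuous (@bumpf R S ([ffun=> 0%N] i)).
  rewrite ffunE => x; have [dx _] := is_derive_bump (S := S) x S0.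
  exact: (differentiable_continuous (iffLR (derivable1_diffP _ _) dx)).
apply: (@cvg_comp _ _ _ (fun u : cube l T => rate * val u ord0 i - (c i)%:R) _ _
   (nbhs (rate * val t ord0 i - (c i)%:R))); last exact: cb.
by apply: (@cvgB _ _ _ (nbhs t) Ft); [apply: (@cvgMl_tmp _ _ (nbhs t) Ft); exact: val_coord_continuous|exact: cvg_cst].
Qed.

Definition cellC c : cubeC l T := CubeC (cellD_cts c).

Definition center c : 'rV[R]_l := \row_i (((c i)%:R + 2^-1) / rate).

Lemma center_cube c : cube l T (center c).
Proof.
move=> i; rewrite mxE divr_ge0 ?addr_ge0 ?invr_ge0 ?(ltW rate0) //= ler_pdivrMr //.
rewrite /rate mulrCA divff ?gt_eqF // mulr1.
have : (c i).+1%:R <= m%:R :> R by rewrite ler_nat.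
by rewrite -natr1; lra.
Qed.

Lemma cellD_center c c' : cellD c' [ffun=> 0%N] (center c) =
  if c' == c then (4^-1 ^+ S.+1) ^+ l else 0.
Proof.
have fac i : rate ^+ ([ffun=> 0%N] : {ffun 'I_l -> nat}) i * bumpf S (([ffun=> 0%N] : {ffun 'I_l -> nat}) i)
     (rate * center c ord0 i - (c' i)%:R) = bumpf S 0 ((c i)%:R + 2^-1 - (c' i)%:R).
  by rewrite ffunE expr0 mul1r mxE [_ * (_ / _)]mulrC divfK // gt_eqF.
rewrite /cellD (eq_bigr _ (fun i _ => fac i)); case: eqVneq => [->|c'c].
  under eq_bigr do rewrite addrAC subrr add0r bump_half.
  by rewrite prodr_const card_ord.
have [i ci] : exists i, c' i != c i.
  apply/existsP; rewrite -[X in is_true X]negbK negb_exists; apply/negP => /forallP H.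
  by case/eqP: c'c; apply/ffunP => i; apply/eqP; rewrite -[_ == _]negbK H.
rewrite (bigD1 i) //= bump_out ?mul0r //.
move: ci; rewrite -val_eqE /= neq_ltn => /orP[]; rewrite -(ler_nat R) -natr1 => h;
  apply/orP; [right|left]; lra.
Qed.

End BumpFamily.

(** Integer and non-integer [gamma] merge here; the last fact says that the weight exponent at the
    top order is [gamma]. *)
Lemma sorder_spec (R : realType) r (gamma : R) : 0 < gamma ->
  [/\ (r < sorder r gamma)%N, 0 <= zeta gamma <= 1 &
    (sorder r gamma)%:R - r%:R - zeta gamma = gamma].
Proof.
move=> g0; rewrite /sorder /zeta; case: ifP => gi.
  have gn : (Num.truncn gamma)%:R = gamma.
    by apply: Num.Theory.truncnK; rewrite Num.Theory.natrEint gi ltW.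
  split; rewrite ?lexx ?ler01 //.
    by rewrite -[ltnLHS]addn0 ltn_add2l -(ltr_nat R) gn.
  by rewrite natrD gn subr0 addrC addKr.
split; first by rewrite ltnS leq_addr.
  have /andP[] := Num.Theory.truncn_itv (ltW g0); rewrite -natr1 => h1 h2.
  by apply/andP; split; lra.
rewrite -natr1 natrD; lra.
Qed.

(** * Lower bound for the Babenko width of the class *)

Section LowerBound.
Variables (R : realType) (l : nat) (T M : R) (r : nat) (gamma : R).
Hypotheses (T0 : 0 < T) (M0 : 0 < M) (l0 : (0 < l)%N) (g0 : 0 < gamma).

Local Notation S := (sorder r gamma).

Let S0 : (0 < S)%N. Proof. by have [/(leq_ltn_trans (leq0n r))] := sorder_spec r g0. Qed.

(** On the cube [|t| <= max 1 T] and the weight exponents lie between [0] and [gamma], so one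
    uniform bound on all derivatives implies the weighted ones. *)
Lemma sum_cellC_class m (a : R) (w : {ffun 'I_l -> 'I_m} -> R) : (0 < m)%N -> 0 <= a ->
  (forall j, (j <= S)%N -> a * ((m%:R / T) ^+ j * bumpC R S ^+ l) <= M / Num.max 1 T `^ gamma) ->
  (forall c, `|w c| <= 1) ->
  Qssclass l T r gamma M (\sum_c w c *: (a *: cellC T S0 c)).
Proof.
move=> m0 a0 abnd w1; have [rS /andP[_ z1] Sg] := sorder_spec r g0.
pose D k t := \sum_c (w c * a) * cellD T S c k t.
have Dle k t : (mdegree k <= S)%N -> `|D k t| <= M / Num.max 1 T `^ gamma.
  move=> kS; apply: le_trans (abnd _ kS).
  apply: le_trans (ler_wpM2l a0 (sum_cellD_le T0 m0 t kS)).
  rewrite (le_trans (ler_norm_sum _ _ _)) // mulr_sumr; apply: ler_sum => c _.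
  rewrite !normrM (ger0_norm a0) ler_wpM2r // ler_piMl //.
have Tg1 : 1 <= Num.max 1 T `^ gamma.
  by rewrite -[leLHS](powRr0 (Num.max 1 T)) ler_powR ?le_max ?lexx // ltW.
have Dpart k i t : (mdegree k < S)%N -> is_partial (cube l T) (D k) i t (D (mincr k i) t).
  move=> kS; apply: is_partial_sum => c _; apply: is_partialZ; apply: cellD_partial => //.
  exact: leq_ltn_trans (leq_mdegree _ _) kS.
exists D; split.
- move=> t; rewrite cubeC_sumE; apply: eq_bigr => c _; rewrite -mulrA; congr (_ * _).
- by move=> k i t kr _; apply: Dpart; exact: ltn_trans kr rS.
- by move=> k i t /andP[_ kS] _ _; exact: Dpart.
- move=> k t kr _; apply: le_trans (Dle k t _) _; first by rewrite (leq_trans kr) // ltnW.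
  by rewrite ler_pdivrMr ?(lt_le_trans ltr01) // ler_peMr // ltW.
- move=> k t /andP[rk kS] tO tn0; apply: le_trans (Dle k t kS) _.
  rewrite ler_wpM2l ?(ltW M0) // lef_pV2 ?posrE ?powR_gt0 ?lt_max ?ltr01 ?normr_gt0 //.
  have e0 : 0 <= (mdegree k)%:R - r%:R - zeta gamma.
    have : r.+1%:R <= (mdegree k)%:R :> R by rewrite ler_nat.
    by rewrite -natr1; lra.
  apply: (@le_trans _ _ (Num.max 1 T `^ ((mdegree k)%:R - r%:R - zeta gamma))).
    apply: ge0_ler_powR => //; rewrite ?nnegrE //; first by rewrite le_max ler01.
    apply: rV_norm_le => [|i]; first by rewrite le_max ler01.
    by have /andP[ti0 tiT] := tO i; rewrite ger0_norm // le_max tiT orbT.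
  rewrite ler_powR ?le_max ?lexx // -[leRHS]Sg !lerD2r ler_nat //.
Qed.

(** [W ^+ S] dominates [T ^- j] for all [j <= S]. Bumps of amplitude [a0 / m ^+ S] then meet every
    derivative bound, and [kappa / m ^+ S] is their height at the cell centers. *)
Let W : R := Num.max 1 T^-1.

Let a0 : R := M / Num.max 1 T `^ gamma / (W ^+ S * bumpC R S ^+ l).

Let a0_gt0 : 0 < a0.
Proof.
rewrite !divr_gt0 ?mulr_gt0 ?exprn_gt0 ?powR_gt0 ?lt_max ?ltr01 //.
exact: lt_le_trans (bumpC_ge1 R S).
Qed.

Let kappa : R := a0 * (4^-1 ^+ S.+1) ^+ l.

Let kappa_gt0 : 0 < kappa.
Proof. by rewrite mulr_gt0 // !exprn_gt0. Qed.

Lemma bump_family m : (0 < m)%N -> exists e : 'I_(m ^ l) -> cubeC l T,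
  (forall w : 'I_(m ^ l) -> R, (forall i, 0 <= w i <= 1) ->
     Qssclass l T r gamma M (\sum_i w i *: e i)) /\
  (forall (w w' : 'I_(m ^ l) -> R) i, kappa / m%:R ^+ S * `|w i - w' i| <=
     `|\sum_i w i *: e i - \sum_i w' i *: e i|).
Proof.
move=> m0; have cardE : #|{ffun 'I_l -> 'I_m}| = (m ^ l)%N by rewrite card_ffun !card_ord.
have mR : 0 < m%:R :> R by rewrite ltr0n.
pose idx (i : 'I_(m ^ l)) : {ffun 'I_l -> 'I_m} := enum_val (cast_ord (esym cardE) i).
pose inv (c : {ffun 'I_l -> 'I_m}) : 'I_(m ^ l) := cast_ord cardE (enum_rank c).
have idxK : cancel idx inv by move=> i; rewrite /idx /inv enum_valK cast_ordKV.
have invK : cancel inv idx by move=> c; rewrite /idx /inv cast_ordK enum_rankK.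
pose a := a0 / m%:R ^+ S.
have a_ge0 : 0 <= a by rewrite ltW // divr_gt0 // exprn_gt0.
exists (fun i => a *: cellC T S0 (idx i)).
have sumE (w : 'I_(m ^ l) -> R) : \sum_i w i *: (a *: cellC T S0 (idx i)) =
    \sum_c w (inv c) *: (a *: cellC T S0 c).
  rewrite (reindex inv) /=; last by exists idx => ? _; [exact: invK|exact: idxK].
  by apply: eq_bigr => c _; rewrite invK.
split=> [w w01|w w' i].
  rewrite sumE; apply: sum_cellC_class => // [j jS|c]; last first.
    by have /andP[w0 w1] := w01 (inv c); rewrite ger0_norm.
  have W1 : 1 <= W by rewrite le_max lexx.
  have C0 : 0 < bumpC R S ^+ l by rewrite exprn_gt0 // (lt_le_trans _ (bumpC_ge1 R S)).
  have W0 : 0 < W ^+ S by rewrite exprn_gt0 // (lt_le_trans _ W1).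
  have mS : (m%:R / T) ^+ j <= m%:R ^+ S * W ^+ S.
    rewrite exprMn ler_pM ?exprn_ge0 ?invr_ge0 ?(ltW T0) //.
      by rewrite ler_weXn2l // ler1n.
    apply: (@le_trans _ _ (W ^+ j)); last by rewrite ler_weXn2l.
    by rewrite lerXn2r ?nnegrE ?invr_ge0 ?(ltW T0) ?(le_trans ler01) // le_max lexx orbT.
  apply: (@le_trans _ _ (a * (m%:R ^+ S * W ^+ S * bumpC R S ^+ l))).
    by rewrite ler_wpM2l // ler_wpM2r // ltW.
  rewrite /a /a0.
  rewrite le_eqVlt; apply/orP; left; apply/eqP; field.
  by rewrite !gt_eqF // ?powR_gt0 ?lt_max ?ltr01 ?exprn_gt0.
(* Evaluation at the center of cell [i] isolates the [i]-th coefficient. *)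
have cO := center_cube T0 m0 (idx i).
pose t : cube l T := exist _ (center T (idx i)) (mem_set cO).
have val_at (v : 'I_(m ^ l) -> R) : (\sum_i v i *: (a *: cellC T S0 (idx i))) t =
    v i * (a * (4^-1 ^+ S.+1) ^+ l).
  have cv j : (a *: cellC T S0 (idx j)) t = a * (if j == i then (4^-1 ^+ S.+1) ^+ l else 0).
    transitivity (a * cellD T S (idx j) [ffun=> 0%N] (center T (idx i))); first by [].
    by rewrite cellD_center // (can_eq idxK).
  rewrite cubeC_sumE (eq_bigr _ (fun j _ => congr1 ( *%R (v j)) (cv j))).
  rewrite (bigD1 i) //= eqxx big1 ?addr0 // => j /negPf ->.
  by rewrite !mulr0.
have := le_supnorm (\sum_i w i *: (a *: cellC T S0 (idx i)) -
   \sum_i w' i *: (a *: cellC T S0 (idx i))) t.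
apply: le_trans.
have -> : (\sum_i w i *: (a *: cellC T S0 (idx i)) -
   \sum_i w' i *: (a *: cellC T S0 (idx i))) t =
   (\sum_i w i *: (a *: cellC T S0 (idx i))) t - (\sum_i w' i *: (a *: cellC T S0 (idx i))) t by [].
rewrite !val_at -mulrBl normrM mulrC ler_wpM2l // ger0_norm ?(mulr_ge0 a_ge0) ?exprn_ge0 //.
by rewrite /a /kappa mulrAC.
Qed.

(** A bump family separates coefficients, hence is independent, and [(n + 1)^l >= n] supplies enough
    bumps. *)
Lemma cubeC_infdim n : exists e : 'I_n -> cubeC l T, lin_indep e.
Proof.
have [e [_ eN]] := @bump_family n.+1 isT.
have nl : (n <= n.+1 ^ l)%N.
  by rewrite (leq_trans (leqnSn n)) // -[leqLHS]expn1 leq_pexp2l.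
exists (e \o widen_ord nl) => w w0 i.
pose w' (j : 'I_(n.+1 ^ l)) : R := if insub (val j) is Some i then w i else 0.
have w'E (j : 'I_n) : w' (widen_ord nl j) = w j by rewrite /w' /= valK.
have w'0 : \sum_j w' j *: e j = 0.
  rewrite -[RHS]w0 (bigID (fun j : 'I_(n.+1 ^ l) => (j < n)%N)) /= [X in _ + X]big1 ?addr0.
    rewrite (big_ord_narrow nl) /=.
    by apply: eq_bigr => j _; rewrite w'E.
  by move=> j jn; rewrite /w' insubN // scale0r.
have z0 : \sum_j (0 : R) *: e j = 0 by rewrite big1 // => j _; rewrite scale0r.
have := eN w' (fun=> 0) (widen_ord nl i); rewrite w'0 w'E z0.
rewrite !subr0 normr0 pmulr_rle0 ?divr_gt0 ?exprn_gt0 // normr_le0.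
by move/eqP.
Qed.

Lemma babenko_width_lower : exists2 c : R, 0 < c & \forall n \near \oo,
  ((c * n%:R `^ (- (S%:R / l%:R)))%:E <= babenko_width n (Qssclass l T r gamma M))%E.
Proof.
exists (kappa / 2 ^+ S); first by rewrite divr_gt0 // exprn_gt0.
exists 1%N => // n /= n1.
pose x : R := n%:R `^ (l%:R^-1).
have n1R : 1 <= n%:R :> R by rewrite ler1n.
have x1 : 1 <= x.
  by rewrite -[leLHS](powRr0 n%:R) ler_powR // invr_ge0.
have xl : x ^+ l = n%:R.
  by rewrite -powR_mulrn ?powR_ge0 // -powRrM mulVf ?powRr1 // pnatr_eq0 -lt0n.
(* [m] exceeds [n^(1/l)] but is at most twice as large: [m^l > n], and [m^(-S)] loses only the
   factor [2^(-S)]. *)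
pose m := (Num.truncn x).+1.
have xm : x < m%:R by exact: Num.Theory.truncnS_gt.
have m2 : m%:R <= 2 * x.
  have : (Num.truncn x)%:R <= x by rewrite Num.Theory.truncn_le (le_trans ler01).
  by rewrite /m -natr1; lra.
have nm : (n < m ^ l)%N.
  by rewrite -(ltr_nat R) natrX -xl ltrXn2r -?lt0n // (le_trans ler01).
have [e [eX eN]] := @bump_family m isT.
apply: le_trans (babenko_width_ge nm eX eN); rewrite lee_fin.
have -> : n%:R `^ (- (S%:R / l%:R)) = x ^- S :> R.
  by rewrite powRN mulrC powRrM powR_mulrn // powR_ge0.
have x0 : 0 < x by rewrite (lt_le_trans ltr01).
rewrite -mulrA -invfM -exprMn ler_wpM2l ?(ltW kappa_gt0) //.
rewrite lef_pV2 ?posrE ?exprn_gt0 ?mulr_gt0 // ?lerXn2r ?nnegrE ?mulr_ge0 ?(ltW x0) //.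
Qed.

End LowerBound.

(** * Discontinuous local approximants and finite nets *)

(** One element is chosen for each label that occurs, so the representatives themselves lie in
    [P]. *)
Lemma finite_representatives (A : Type) (P : set A) (L : finType) (lab : A -> L) :
  exists J : finType, exists2 z : J -> A, (forall j, P (z j)) &
    forall t, P t -> exists j, lab (z j) = lab t.
Proof.
pose J := {c : L | `[< exists2 t, P t & lab t = c >]}.
have /choice[z zE] : forall j : J, exists t, P t /\ lab t = val j.
  by move=> [c /= /asboolP[t Pt tc]]; exists t.
exists J, z => [j|t Pt]; first by have [] := zE j.
have ct : `[< exists2 t', P t' & lab t' = lab t >] by apply/asboolP; exists t.
by exists (exist _ (lab t) ct); have [_ ->] := zE (exist _ (lab t) ct).
Qed.

Section RealCells.
Variables (R : realType) (d C : R).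

Definition rcell (x : R) : 'I_(Num.truncn (C / d)).+1 := inord (Num.truncn (x / d)).

Lemma rcell_close x y : 0 < d -> 0 <= x <= C -> 0 <= y <= C -> rcell x = rcell y ->
  `|x - y| < d.
Proof.
move=> d0 /andP[x0 xC] /andP[y0 yC] /(congr1 val) /=.
rewrite !inordK; first last.
- by rewrite ltnS Num.Theory.le_truncn // ler_pM2r // invr_gt0.
- by rewrite ltnS Num.Theory.le_truncn // ler_pM2r // invr_gt0.
move=> xy; have := Num.Theory.truncn_itv (divr_ge0 x0 (ltW d0)).
have := Num.Theory.truncn_itv (divr_ge0 y0 (ltW d0)).
rewrite xy !ler_pdivlMr ?ltr_pdivrMr ?ltr_pdivrMr //.
set k := Num.truncn _; rewrite -[k.+1%:R]natr1 mulrDl mul1r => /andP[y1 y2] /andP[x1 x2].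
by rewrite ltr_norml; apply/andP; split; lra.
Qed.

End RealCells.

(** * Nets of the cube and of Lipschitz classes, interpolation on a net *)

Section Nets.
Variables (R : realType) (l : nat) (T : R).

Lemma cube_net (d : R) : 0 < d -> exists J : finType, exists z : J -> cube l T,
  forall t : cube l T, exists j, `|val t - val (z j)| < d.
Proof.
move=> d0; have d2 : 0 < d / 2 by rewrite divr_gt0.
have [J [z _ zE]] := @finite_representatives (cube l T) setT _
  (fun t => [ffun i => rcell (d / 2) T (val t ord0 i)] : {ffun 'I_l -> _}).
exists J, z => t; have [j ljt] := zE t I; exists j.
have cO (u : cube l T) : cube l T (val u) by case: u => u /= /set_mem.
apply: (@le_lt_trans _ _ (d / 2)); last by rewrite ltr_pdivrMr // ltr_pMr // ltr1n.
apply: rV_norm_le => [|i]; first exact: ltW.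
rewrite !mxE; apply/ltW/(rcell_close (C := T)) => //; try exact: cO.
by have := congr1 (fun f : {ffun _} => f i) ljt; rewrite !ffunE.
Qed.

Variables (X : set (cubeC l T)) (Lip : R).
Hypothesis Lip_ge0 : 0 <= Lip.
Hypothesis XLip : forall f t u, X f -> `|f t - f u| <= Lip * `|val t - val u|.

(** Quantitative Arzela-Ascoli: functions are labelled by their rounded values on a net of the cube,
    and the Lipschitz bound bridges the gaps. *)
Lemma class_net (M : R) : (forall f t, X f -> `|f t| <= M) ->
  forall e : R, 0 < e -> exists J : finType, exists2 b : J -> cubeC l T,
    (forall j, X (b j)) & forall x, X x -> exists j, `|x - b j| < e.
Proof.
move=> XM e e0; pose d := e / (4 * (Lip + 1)).
have L1 : 0 < Lip + 1 by rewrite ltr_wpDl.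
have d0 : 0 < d by rewrite divr_gt0 // mulr_gt0.
have [J [z zE]] := cube_net d0.
have e4 : 0 < e / 4 by rewrite divr_gt0.
have [J' [b Xb bE]] := @finite_representatives _ X _
  (fun f => [ffun j => rcell (e / 4) (2 * M) (f (z j) + M)] : {ffun J -> _}).
exists J', b => // f Xf; have [j' jf] := bE f Xf; exists j'.
apply: (@le_lt_trans _ _ (3 * (e / 4))); last by lra.
apply: (@supnorm_le R l T (f - b j')) => [|t]; first by rewrite mulr_ge0 // ltW.
have [j tj] := zE t.
have Lj (g : cubeC l T) : X g -> `|g t - g (z j)| <= e / 4.
  move=> Xg; apply: (le_trans (XLip t (z j) Xg)).
  apply: (@le_trans _ _ ((Lip + 1) * d)).
    by rewrite ler_pM // ?lerDl // ltW.
  by rewrite /d le_eqVlt; apply/orP; left; apply/eqP; field; rewrite gt_eqF.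
have -> : (f - b j') t = (f t - f (z j)) + (f (z j) - b j' (z j)) + (b j' (z j) - b j' t).
  by rewrite !subrKA.
rewrite (le_trans (ler_normD _ _)) // (_ : 3 * (e / 4) = e / 4 + e / 4 + e / 4); last by field.
rewrite lerD //; last by rewrite distrC Lj.
rewrite (le_trans (ler_normD _ _)) // lerD ?Lj //.
have in0 (g : cubeC l T) : X g -> 0 <= g (z j) + M <= 2 * M.
  by move=> Xg; have := XM g (z j) Xg; rewrite ler_norml => /andP[]; lra.
have -> : f (z j) - b j' (z j) = (f (z j) + M) - (b j' (z j) + M).
  by rewrite opprD addrACA subrr addr0.
apply/ltW/(rcell_close e4 (in0 _ Xf) (in0 _ (Xb j'))).
by have := congr1 (fun h : {ffun _} => h j) jf; rewrite !ffunE.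
Qed.

(* The local approximants may jump from one label to the next; sampling them on
   a fine net and interpolating restores continuity. *)
Lemma discretize (L A : finType) (lab : cube l T -> L) (phi : L -> A -> cube l T -> R)
    (eps eta : R) : 0 <= eps -> 0 < eta ->
  (forall f, X f -> exists c : L -> A -> R,
     forall t, `|f t - \sum_a c (lab t) a * phi (lab t) a t| <= eps) ->
  exists e : 'I_(#|L| * #|A|) -> cubeC l T, forall f, X f ->
    exists c : 'I_(#|L| * #|A|) -> R, `|f - \sum_i c i *: e i| <= eps + eta.
Proof.
move=> eps0 eta0 Xphi; pose d := eta / (Lip + 1).
have L1 : 0 < Lip + 1 by rewrite ltr_wpDl.
have d0 : 0 < d by rewrite divr_gt0.
have [J [z zE]] := cube_net d0.
pose D (t : cube l T) j := `|val t - val (z j)|.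
have cD (t : cube l T) j : {for t, continuous (D^~ j)}.
  have Ft : Filter (nbhs t) by exact: nbhs_filter.
  apply: (@cvg_norm _ _ _ (nbhs t) Ft).
  apply: (@cvgB _ _ _ (nbhs t) Ft); last exact: cvg_cst.
  exact: (@initial_continuous _ _ (val : cube l T -> 'rV[R]_l) t).
(* Samples with another label are set to zero; each pair [(c, a)] thus gives one continuous
   function, and the count is independent of the size of the net. *)
pose g (c : L) (a : A) (t : cube l T) : R :=
  \sum_j pou D d j t *: (if lab (z j) == c then phi c a (z j) else 0).
have gC c a : g c a \in @ctsfun R l T.
  apply/ctsfunP => t; have Ft : Filter (nbhs t) by exact: nbhs_filter.
  apply: (@cvg_sumr _ _ _ (nbhs t) Ft) => j.
  apply: (@cvgZr_tmp _ _ _ (nbhs t) Ft).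
  by have [k tk] := zE t; apply: (pou_continuous (j := k)).
pose e0 (ca : L * A) : cubeC l T := CubeC (gC ca.1 ca.2).
have cardE : #|{: L * A}| = (#|L| * #|A|)%N by rewrite card_prod.
exists (fun i => e0 (enum_val (cast_ord (esym cardE) i))) => f Xf.
have [c cf] := Xphi f Xf.
exists (fun i => let ca := enum_val (cast_ord (esym cardE) i) in c ca.1 ca.2).
apply: supnorm_le => [|t].
  by rewrite addr_ge0 // ltW.
pose v j := \sum_a c (lab (z j)) a * phi (lab (z j)) a (z j).
set sm := \sum_i _.
have -> : (f - sm) t = f t - \sum_j pou D d j t *: v j.
  transitivity (f t - sm t); first by [].
  rewrite {}/sm.
  congr (_ - _); transitivity (\sum_ca c ca.1 ca.2 * e0 ca t).
    rewrite cubeC_sumE [RHS](reindex (fun i => enum_val (cast_ord (esym cardE) i))) //=.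
    by exists (fun ca => cast_ord cardE (enum_rank ca)) => i _; rewrite ?enum_valK ?cast_ordKV ?cast_ordK ?enum_rankK.
  rewrite -(pair_bigA _ (fun i a => c i a * g i a t)) /=.
  under eq_bigr do under eq_bigr do rewrite /g mulr_sumr.
  under eq_bigr do rewrite exchange_big /=.
  rewrite exchange_big; apply: eq_bigr => j _ /=.
  rewrite (bigD1 (lab (z j))) //= [X in _ + X]big1 ?addr0 => [|i /negPf ij]; last first.
    by rewrite big1 // => a _; rewrite eq_sym ij scaler0 mulr0.
  rewrite scaler_sumr; apply: eq_bigr => a _; rewrite eqxx.
  by rewrite /GRing.scale /= mulrCA.
have [k tk] := zE t; apply: (pou_approx tk) => j tj.
rewrite -(subrKA (f (z j))) (le_trans (ler_normD _ _)) // addrC lerD ?cf //.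
apply: (le_trans (XLip t (z j) Xf)).
apply: (@le_trans _ _ ((Lip + 1) * d)).
  by rewrite ler_pM // ?lerDl // ltW.
by rewrite /d le_eqVlt; apply/orP; left; apply/eqP; field; rewrite gt_eqF.
Qed.

End Nets.

(** * Graded cells and the upper bound *)

Section ClassTaylor.
Variables (R : realType) (l : nat) (T M : R) (r : nat) (gamma : R).
Hypotheses (T0 : 0 < T) (M0 : 0 < M) (r0 : (0 < r)%N) (g0 : 0 < gamma).

Local Notation S := (sorder r gamma).
Local Notation X := (Qssclass l T r gamma M).

Lemma cube_val (t : cube l T) : cube l T (val t).
Proof. by case: t => t /= /set_mem. Qed.

(** The first estimate uses only the bound [M] on first derivatives. In the second, a coordinate
    that is at least [rho] at both points stays so on the box between them; the box avoids the
    origin and the weighted bound of order [S] applies. *)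
Lemma class_taylor f : X f -> exists D : {ffun 'I_l -> nat} -> 'rV[R]_l -> R,
  [/\ forall t : cube l T, D [ffun=> 0%N] (val t) = f t,
    forall (x y : cube l T) (h : R), (forall i, `|val y ord0 i - val x ord0 i| <= h) ->
      `|f y - taylor D S 1 (val x) [ffun=> 0%N] (val y)| <= l%:R * h * M &
    forall (x y : cube l T) (h rho : R) i, (forall i, `|val y ord0 i - val x ord0 i| <= h) ->
      0 < rho -> rho <= val x ord0 i -> rho <= val y ord0 i ->
      `|f y - taylor D S S (val x) [ffun=> 0%N] (val y)| <= (l%:R * h) ^+ S * (M / rho `^ gamma)].
Proof.
move=> [D [D0 Dr Ds] [Br Bs]]; have [rS /andP[z0 z1] Sg] := sorder_spec r g0.
have deg0 : mdegree ([ffun=> 0%N] : {ffun 'I_l -> nat}) = 0%N.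
  by rewrite /mdegree big1 // => i _; rewrite ffunE.
exists D; split=> // [x y h xyh|x y h rho i xyh rho0 rx ry].
  rewrite -D0 -[_ * h]expr1.
  apply: (@taylor_error R l T D S 1); rewrite ?deg0 //; try exact: cube_val.
  - exact: leq_ltn_trans rS.
  - move=> u k' i xyu /andP[_]; rewrite add0n ltnS leqn0 => /eqP k0.
    by apply: Dr; rewrite ?k0 //; apply: between_cube xyu; exact: cube_val.
  - move=> u k' xyu k1; apply: Br; first by rewrite k1.
    by apply: between_cube xyu; exact: cube_val.
rewrite -D0; apply: (@taylor_error R l T D S S); rewrite ?deg0 //; try exact: cube_val.
- move=> u k' j xyu /andP[_]; rewrite add0n => kS.
  have uO : cube l T u by apply: between_cube xyu; exact: cube_val.
  have ui : rho <= u ord0 i by have /andP[+ _] := xyu i; apply: le_trans; rewrite le_min rx.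
  have u0 : u != 0 by apply: contraTneq ui => ->; rewrite mxE -ltNge.
  by case: (ltnP (mdegree k') r) => kr; [exact: Dr|apply: Ds => //; rewrite kr].
- move=> u k' xyu; rewrite add0n => kS.
  have uO : cube l T u by apply: between_cube xyu; exact: cube_val.
  have ui : rho <= u ord0 i by have /andP[+ _] := xyu i; apply: le_trans; rewrite le_min rx.
  have u0 : u != 0 by apply: contraTneq ui => ->; rewrite mxE -ltNge.
  have := Bs k' u; rewrite kS rS leqnn Sg => /(_ isT uO u0) /le_trans; apply.
  have ru : rho <= `|u|.
    by apply: le_trans ui _; apply: le_trans (coord_le_norm u i); exact: ler_norm.
  rewrite ler_wpM2l ?(ltW M0) // lef_pV2 ?posrE ?powR_gt0 ?(lt_le_trans rho0) //.
  by apply: ge0_ler_powR => //; rewrite ?nnegrE ?(ltW g0) ?(ltW rho0).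
Qed.

Lemma class_bounded f t : X f -> `|f t| <= M.
Proof.
move=> [D [D0 _ _] [Br _]]; rewrite -D0; apply: Br; last exact: cube_val.
by rewrite /mdegree big1 // => i _; rewrite ffunE.
Qed.

Lemma class_lipschitz f t u : X f -> `|f t - f u| <= l%:R * M * `|val t - val u|.
Proof.
move=> Xf; have [rS _ _] := sorder_spec r g0.
have [D [D0 D1 _]] := class_taylor Xf; have := D1 u t `|val t - val u|.
rewrite taylor1 ?D0; last exact: leq_ltn_trans rS.
rewrite mulrAC; apply => i.
by have := coord_le_norm (val t - val u) i; rewrite !mxE.
Qed.

End ClassTaylor.

Lemma sum_geometric_le (R : realFieldType) (q : R) n : 0 <= q < 1 ->
  \sum_(j < n) q ^+ j <= (1 - q)^-1.
Proof.
move=> /andP[q0 q1]; have q1' : 0 < 1 - q by rewrite subr_gt0.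
rewrite -[leRHS]mul1r ler_pdivlMr // mulrC.
have := subrX1 q n; rewrite -opprB -[in RHS]opprB mulNr => /oppr_inj <-.
by rewrite lerBlDr lerDl exprn_ge0.
Qed.

(** * Dyadic shells and their subdivision into cells *)

Section DyadicCells.
Variables (R : realType) (l : nat) (T : R) (J : nat) (m : nat -> nat).
Hypotheses (T0 : 0 < T) (l0 : (0 < l)%N) (m0 : forall j, (0 < m j)%N).

Definition radius j : R := T / 2 ^+ j.

Definition mesh j : R := radius j / (m j)%:R.

(* [None] labels the core around the origin. *)
Definition label := option {j : 'I_J & ('I_l * {ffun 'I_l -> 'I_(m j).+1})%type}.

(** [i] records a coordinate of size at least half the outer radius, common to the points of the
    cell as [class_taylor] requires. The closed conditions let cells overlap; one label per point is
    selected later. *)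
Definition in_cell (t : 'rV[R]_l) (c : label) : Prop :=
  if c is Some (existT j (i, b)) then
    radius j.+1 <= t ord0 i /\
    forall i, (b i)%:R * mesh j <= t ord0 i <= ((b i).+1)%:R * mesh j
  else forall i, 0 <= t ord0 i <= radius J.

Lemma radius_gt0 j : 0 < radius j.
Proof. by rewrite divr_gt0 // exprn_gt0. Qed.

Lemma mesh_gt0 j : 0 < mesh j.
Proof. by rewrite divr_gt0 ?radius_gt0 // ltr0n. Qed.

Lemma in_cell_total t : cube l T t -> exists c, in_cell t c.
Proof.
move=> tO; have [core|] := pselect (forall i, 0 <= t ord0 i <= radius J).
  by exists None.
move=> /existsNP[i0 ti0].
pose P j := [forall i, t ord0 i <= radius j].
have P0 : P 0%N by apply/forallP => i; have /andP[_] := tO i; rewrite /radius expr0 divr1.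
have PJ : ~~ P J.
  apply/negP => /forallP PJ; apply: ti0.
  by have /andP[-> _] := tO i0; exact: PJ.
have [j [jJ Pj nPj]] : exists j, [/\ (j < J)%N, P j & ~~ P j.+1].
  move: PJ; elim: (J) => [|j IH]; first by rewrite P0.
  move=> nPj; have [Pj|/IH[k [kj Pk nPk]]] := boolP (P j); first by exists j.
  by exists k; split=> //; exact: ltnW.
move: nPj; rewrite negb_forall => /existsP[i]; rewrite -ltNge => ti.
(* A coordinate equal to [radius j] gets the index [m j], whence [(m j).+1] indices per axis. *)
have bnd (k : 'I_l) : (Num.truncn (t ord0 k / mesh j) < (m j).+1)%N.
  rewrite ltnS -(ler_nat R); have /andP[tk0 _] := tO k.
  apply: (@le_trans _ _ (t ord0 k / mesh j)).
    by rewrite Num.Theory.truncn_le divr_ge0 // ltW // mesh_gt0.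
  rewrite ler_pdivrMr ?mesh_gt0 // /mesh mulrCA divff ?mulr1; last first.
    by rewrite pnatr_eq0 -lt0n.
  by have /forallP := Pj; apply.
exists (Some (existT _ (Ordinal jJ) (i, [ffun k => Ordinal (bnd k)]))); split; first exact: ltW.
move=> k; rewrite ffunE /=; have /andP[tk0 _] := tO k.
have := Num.Theory.truncn_itv (divr_ge0 tk0 (ltW (mesh_gt0 j))).
by rewrite ler_pdivlMr ?mesh_gt0 // ltr_pdivrMr ?mesh_gt0 // => /andP[-> /ltW ->].
Qed.

Lemma card_label : #|{: label}| = (1 + \sum_(j < J) l * (m j).+1 ^ l)%N.
Proof.
rewrite card_option add1n card_tagged sumnE big_map big_enum /=; congr _.+1.
by apply: eq_bigr => j _; rewrite card_prod card_ffun !card_ord.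
Qed.

End DyadicCells.

(** * Graded Taylor approximation: error and number of pieces *)

Section UpperBound.
Variables (R : realType) (l : nat) (T M : R) (r : nat) (gamma : R).
Hypotheses (T0 : 0 < T) (M0 : 0 < M) (l0 : (0 < l)%N) (r0 : (0 < r)%N) (g0 : 0 < gamma).

Local Notation S := (sorder r gamma).
Local Notation X := (Qssclass l T r gamma M).

Let S0 : (0 < S)%N.
Proof. by have [rS _ _] := sorder_spec r g0; exact: leq_ltn_trans rS. Qed.

Let SR : 0 < S%:R :> R. Proof. by rewrite ltr0n. Qed.

(** From one shell to the next the derivative bound grows by [2^gamma = theta^S], so the mesh
    shrinks by [theta] while the radius halves: the number of subdivisions scales by [q], and
    [q < 1] because [gamma < S]. *)
Let theta : R := 2 `^ (gamma / S%:R).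
Let q : R := theta / 2.

Let theta_gt0 : 0 < theta. Proof. by rewrite powR_gt0. Qed.

Let theta_S : theta ^+ S = 2 `^ gamma.
Proof. by rewrite -powR_mulrn ?powR_ge0 // -powRrM divfK // gt_eqF. Qed.

Let q01 : 0 <= q < 1.
Proof.
rewrite divr_ge0 ?(ltW theta_gt0) //= ltr_pdivrMr // mul1r.
have [rS /andP[z0 _] Sg] := sorder_spec r g0.
have r1 : 1 <= r%:R :> R by rewrite ler1n.
have gS : gamma / S%:R < 1 by rewrite ltr_pdivrMr // mul1r -[ltLHS]Sg; lra.
rewrite -[ltRHS]powRr1 // ltNge; apply/negP => h.
have : ln (2 `^ 1) <= ln theta :> R by rewrite ler_ln ?posrE ?powR_gt0.
rewrite !ln_powR ler_pM2r; first by rewrite leNgt gS.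
by rewrite ln_gt0 // ltr1n.
Qed.

Section Dyadic.
Variable p : nat.
Local Notation N := (2 ^+ p : R).
(** With [S * p] shells the core has side [T / N ^+ S], small enough for a constant approximant. *)
Local Notation J := (S * p)%N.

Definition subdiv j : nat := (Num.truncn (N * q ^+ j)).+1.

Let N0 : 0 < N. Proof. by rewrite exprn_gt0. Qed.

Let Nq0 j : 0 <= N * q ^+ j.
Proof. by have /andP[q0 _] := q01; rewrite mulr_ge0 ?exprn_ge0 // ltW. Qed.

(** The mesh is at most [T / (N theta^j)]; its [S]-th power brings [theta^(j S) = 2^(gamma j)] into
    the denominator, which cancels the growth of the weight. *)
Lemma mesh_error j :
  (l%:R * mesh T subdiv j) ^+ S * (M / radius T j.+1 `^ gamma) <=
  (l%:R * T) ^+ S * M * 2 `^ gamma / T `^ gamma / N ^+ S.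
Proof.
have j2 : 0 < 2 ^+ j :> R by rewrite exprn_gt0.
have tj : 0 < theta ^+ j by rewrite exprn_gt0.
have mle : mesh T subdiv j <= T / (N * theta ^+ j).
  have -> : T / (N * theta ^+ j) = radius T j / (N * q ^+ j).
    by rewrite /radius /q expr_div_n; field; rewrite !gt_eqF.
  rewrite /mesh ler_wpM2l ?(ltW (radius_gt0 _ _)) // lef_pV2 ?posrE ?ltr0n //.
    by rewrite ltW // Num.Theory.truncnS_gt.
  by rewrite mulr_gt0 // exprn_gt0 // divr_gt0.
have rE : radius T j.+1 `^ gamma = T `^ gamma / (2 `^ gamma) ^+ j.+1.
  rewrite /radius powRM ?invr_ge0 ?exprn_ge0 ?(ltW T0) //; congr (_ * _).
  rewrite -(powR_invn j.+1 (ler0n R 2)) powRAC powR_invn // powR_ge0.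
apply: (@le_trans _ _ ((l%:R * (T / (N * theta ^+ j))) ^+ S * (M / radius T j.+1 `^ gamma))).
  rewrite ler_wpM2r ?divr_ge0 ?powR_ge0 ?(ltW M0) // lerXn2r ?nnegrE //.
  - by rewrite mulr_ge0 // ltW // mesh_gt0.
  - by rewrite mulr_ge0 // divr_ge0 ?(ltW T0) // ltW // mulr_gt0.
  - by rewrite ler_wpM2l.
rewrite rE le_eqVlt; apply/orP; left; apply/eqP.
rewrite [l%:R * (_ / _)]mulrA expr_div_n [(N * _) ^+ S]exprMn [_ ^+ j.+1]exprS.
have -> : (theta ^+ j) ^+ S = (2 `^ gamma) ^+ j by rewrite -exprM mulnC exprM theta_S.
field.
by rewrite !gt_eqF ?exprn_gt0 ?powR_gt0.
Qed.

Definition cell_error : R := (l%:R * T) ^+ S * M * 2 `^ gamma / T `^ gamma + l%:R * T * M.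

Lemma cell_error_ge0 : 0 <= cell_error.
Proof.
by rewrite addr_ge0 ?mulr_ge0 ?exprn_ge0 ?mulr_ge0 ?invr_ge0 ?powR_ge0 ?(ltW T0) ?(ltW M0).
Qed.

Lemma dyadic_approx : exists e : 'I_(#|{: label l J subdiv}| * #|{: {ffun 'I_l -> 'I_S}}|) -> cubeC l T,
  forall f, X f -> exists c : _ -> R, `|f - \sum_i c i *: e i| <= (cell_error + 1) / N ^+ S.
Proof.
have /choice[lab labE] : forall t : cube l T, exists c : label l J subdiv, in_cell T (val t) c.
  by move=> t; apply: in_cell_total => //; exact: cube_val.
have cube0 : cube l T 0 by move=> i; rewrite mxE lexx ltW.
pose t0 : cube l T := exist _ 0 (mem_set cube0).
(* The expansion point of a cell is a point with that label; labels that never occur get the default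
   [t0]. *)
have /choice[rep repE] : forall c, exists x : cube l T,
    (exists t, lab t = c) -> lab x = c.
  move=> c; have [[t tc]|nt] := pselect (exists t, lab t = c); first by exists t.
  by exists t0 => /nt.
pose phi c (a : {ffun 'I_l -> 'I_S}) (t : cube l T) := mono (val (rep c)) (mindex a) (val t).
rewrite mulrDl mul1r; apply: (@discretize R l T X (l%:R * M) _ _ _ _ lab phi).
- by rewrite mulr_ge0 // ltW.
- by move=> f t u; exact: class_lipschitz.
- by rewrite divr_ge0 ?cell_error_ge0 // exprn_ge0 // ltW.
- by rewrite invr_gt0 exprn_gt0.
move=> f Xf; have [D [_ D1 DS]] := class_taylor M0 r0 g0 Xf.
(* Constants in the core, order [S] in the shells; the coefficients above this order are zero since
   all labels share one index set. *)
pose ord (c : label l J subdiv) := if c is None then 1%N else S.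
exists (fun c a => if (mdegree (mindex a) < ord c)%N then
   D (madd [ffun=> 0%N] (mindex a)) (val (rep c)) else 0) => t.
have -> : \sum_a (if (mdegree (mindex a) < ord (lab t))%N then
   D (madd [ffun=> 0%N] (mindex a)) (val (rep (lab t))) else 0) * phi (lab t) a t =
   taylor D S (ord (lab t)) (val (rep (lab t))) [ffun=> 0%N] (val t).
  rewrite /taylor [RHS]big_mkcond; apply: eq_bigr => a _.
  by case: ifP => // _; rewrite mul0r.
have labr : lab (rep (lab t)) = lab t by apply: repE; exists t.
have NS : 0 < N ^+ S by rewrite exprn_gt0.
have := labE t; have := labE (rep (lab t)); rewrite labr.
case: (lab t) => [[j [i b]]|] /=.
  move=> [xr xb] [tr tb]; set x := rep _ in xr xb *.
  apply: (@le_trans _ _ ((l%:R * mesh T subdiv j) ^+ S * (M / radius T j.+1 `^ gamma))).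
    apply: (DS x t _ _ i) => //; last exact: radius_gt0.
    move=> k; move: (xb k) (tb k) => /andP[x1 x2] /andP[t1 t2].
    rewrite -natr1 mulrDl mul1r in x2 t2.
    by rewrite ler_norml; apply/andP; split; lra.
  apply: le_trans (mesh_error j) _; rewrite ler_wpM2r ?invr_ge0 ?(ltW NS) // lerDl.
  by rewrite !mulr_ge0 // ltW.
move=> xr tr; set x := rep _ in xr *.
apply: le_trans (D1 x t (radius T J) _) _.
  move=> k; move: (xr k) (tr k) => /andP[x1 x2] /andP[t1 t2].
  by rewrite ler_norml; apply/andP; split; lra.
rewrite /radius (_ : 2 ^+ J = N ^+ S); last by rewrite -exprM mulnC.
rewrite (_ : l%:R * (T / N ^+ S) * M = l%:R * T * M / N ^+ S); last by field; rewrite gt_eqF.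
rewrite ler_wpM2r ?invr_ge0 ?(ltW NS) // lerDr.
by rewrite !mulr_ge0 ?exprn_ge0 ?mulr_ge0 ?invr_ge0 ?powR_ge0 ?(ltW T0) ?(ltW M0).
Qed.

Definition cell_count : R := 1 + l%:R * 2 ^+ l * ((1 - q)^-1 + S%:R * 2 ^+ l).

(** Shell [j] costs a multiple of [(N q^j)^l + 2^l]. Since [q^(j l) <= q^j], the first terms sum to
    a geometric series times [N^l]; the second ones, one per shell, total [S p 2^l], and
    [p <= 2^p = N <= N^l]. *)
Lemma card_label_le : #|{: label l J subdiv}|%:R <= cell_count * N ^+ l.
Proof.
have /andP[q0 q1] := q01.
have N1 : 1 <= N by rewrite exprn_ege1 // ler1n.
have Nl1 : 1 <= N ^+ l by rewrite exprn_ege1.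
rewrite card_label natrD natr_sum /cell_count mulrDl mul1r lerD //.
have step j : (l * (subdiv j).+1 ^ l)%:R <= l%:R * 2 ^+ l * (N ^+ l * q ^+ j + 2 ^+ l).
  rewrite natrM natrX -mulrA ler_wpM2l //.
  have sle : (subdiv j).+1%:R <= N * q ^+ j + 2.
    by rewrite /subdiv -addn2 natrD lerD2r Num.Theory.truncn_le.
  apply: (@le_trans _ _ ((N * q ^+ j + 2) ^+ l)).
    by rewrite lerXn2r ?nnegrE // addr_ge0.
  have qjl : (q ^+ j) ^+ l <= q ^+ j.
    rewrite -[leRHS]expr1 ler_wiXn2l ?exprn_ge0 // exprn_ile1 // ltW //.
  (* This gives [(a + b)^l <= 2^l max(a, b)^l <= 2^l (a^l + b^l)]. *)
  have maxP : N * q ^+ j + 2 <= 2 * Num.max (N * q ^+ j) 2.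
    have : N * q ^+ j <= Num.max (N * q ^+ j) 2 by rewrite le_max lexx.
    have : 2 <= Num.max (N * q ^+ j) 2 by rewrite le_max lexx orbT.
    by lra.
  apply: (@le_trans _ _ ((2 * Num.max (N * q ^+ j) 2) ^+ l)).
    by rewrite lerXn2r ?nnegrE ?addr_ge0 // mulr_ge0 // le_max ler0n orbT.
  rewrite exprMn ler_wpM2l ?exprn_ge0 //.
  apply: (@le_trans _ _ ((N * q ^+ j) ^+ l + 2 ^+ l)).
    by rewrite /Num.max; case: ifP => _; rewrite ?lerDl ?lerDr exprn_ge0.
  by rewrite lerD2r exprMn ler_wpM2l // exprn_ge0 // ltW.
apply: le_trans (ler_sum _ (fun j _ => step (val j))) _.
rewrite -mulr_sumr -[leRHS]mulrA ler_wpM2l ?mulr_ge0 ?exprn_ge0 //.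
rewrite big_split /= -mulr_sumr sumr_const card_ord mulrDl lerD //.
  by rewrite mulrC ler_wpM2r ?exprn_ge0 ?(ltW N0) // sum_geometric_le // q0.
rewrite -[leLHS]mulr_natr natrM.
rewrite (_ : 2 ^+ l * (S%:R * p%:R) = S%:R * 2 ^+ l * p%:R); last by ring.
rewrite ler_wpM2l ?mulr_ge0 ?exprn_ge0 //.
apply: (@le_trans _ _ N); first by rewrite -natrX ler_nat ltnW // ltn_expl.
by rewrite -[leLHS]expr1 ler_weXn2l.
Qed.

End Dyadic.
End UpperBound.

(** * Upper bound for the Kolmogorov width of the class *)

Section KolmogorovUpper.
Variables (R : realType) (l : nat) (T M : R) (r : nat) (gamma : R).
Hypotheses (T0 : 0 < T) (M0 : 0 < M) (l0 : (0 < l)%N) (r0 : (0 < r)%N) (g0 : 0 < gamma).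

Local Notation S := (sorder r gamma).
Local Notation X := (Qssclass l T r gamma M).

Lemma kolmogorov_width_upper : exists2 C : R, 0 < C & \forall n \near \oo,
  (kolmogorov_width n X <= (C * n%:R `^ (- (S%:R / l%:R)))%:E)%E.
Proof.
pose C0 : R := cell_error l T M r gamma + 1.
have C00 : 0 < C0 by rewrite ltr_wpDl // cell_error_ge0.
(* At level [p] the approximants number at most [K (2^p)^l]: labels times the [S^l]
   multi-indices. *)
pose K : R := cell_count l r gamma * (S%:R ^+ l).
have K0 : 0 < K.
  have [rS _ _] := sorder_spec r g0.
  have := card_label_le l0 r0 g0 0; rewrite expr0 expr1n mulr1 => cc.
  rewrite mulr_gt0 ?exprn_gt0 ?ltr0n //; last exact: leq_ltn_trans rS.
  by apply: lt_le_trans cc; rewrite ltr0n card_option.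
have l1 : 0 <= l%:R^-1 :> R by rewrite invr_ge0.
have lR : l%:R != 0 :> R by rewrite pnatr_eq0 -lt0n.
exists (C0 * 2 ^+ S * K `^ (S%:R / l%:R)); first by rewrite !mulr_gt0 ?exprn_gt0 ?powR_gt0.
exists (Num.truncn K).+1 => // n /= nK.
have Kn : K < n%:R by rewrite (lt_le_trans (Num.Theory.truncnS_gt K)) // ler_nat.
have n0 : 0 < n%:R :> R by rewrite (lt_trans K0).
pose y : R := (n%:R / K) `^ l%:R^-1.
have nK1 : 1 <= n%:R / K by rewrite ler_pdivlMr // mul1r ltW.
have y1 : 1 <= y by rewrite -[leLHS](powRr0 (n%:R / K)) ler_powR.
have y0 : 0 < y by rewrite (lt_le_trans ltr01).
have yl : y ^+ l = n%:R / K.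
  by rewrite -powR_mulrn ?powR_ge0 // -powRrM mulVf // powRr1 // (le_trans ler01).
(* The largest level that [n] functions allow: [2^p <= y < 2 * 2^p], the factor [2] producing the
   constant [2 ^+ S]. *)
pose k := Num.truncn y; pose p := trunc_log 2 k.
have k0 : (0 < k)%N by rewrite Num.Theory.truncn_gt0.
have py : 2 ^+ p <= y.
  apply: (@le_trans _ _ k%:R); last by rewrite Num.Theory.truncn_le ltW.
  by rewrite -natrX ler_nat trunc_logP.
have yp : y < 2 * 2 ^+ p.
  apply: (@lt_le_trans _ _ k.+1%:R); first exact: Num.Theory.truncnS_gt.
  by rewrite -exprS -natrX ler_nat trunc_log_ltn.
have [e eX] := @dyadic_approx R l T M r gamma T0 M0 r0 g0 p.
apply: (@le_trans _ _ (C0 / (2 ^+ p) ^+ S)%:E).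
  apply: kolmogorov_width_le eX; first by apply: cubeC_infdim => //; exact: l0.
  rewrite -(ler_nat R) natrM card_ffun !card_ord natrX.
  apply: (@le_trans _ _ (cell_count l r gamma * (2 ^+ p) ^+ l * S%:R ^+ l)).
    by rewrite ler_wpM2r ?exprn_ge0 // card_label_le.
  rewrite mulrAC -/K -ler_pdivlMl // mulrC -yl.
  by rewrite lerXn2r ?nnegrE ?exprn_ge0 // ltW.
rewrite lee_fin -!mulrA ler_wpM2l ?(ltW C00) //.
have -> : 2 ^+ S * (K `^ (S%:R / l%:R) * n%:R `^ (- (S%:R / l%:R))) = (2 / y) ^+ S.
  have -> : (2 / y) ^+ S = 2 ^+ S / (n%:R `^ (S%:R / l%:R) / K `^ (S%:R / l%:R)).
    rewrite expr_div_n -[y ^+ S]powR_mulrn ?powR_ge0 // -powRrM [l%:R^-1 * _]mulrC.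
    rewrite powRM ?invr_ge0 ?ler0n ?(ltW K0) //.
    by rewrite -[in K^-1 `^ _]powR_inv1 ?(ltW K0) // -powRrM mulN1r powRN.
  by rewrite powRN; field; rewrite !gt_eqF ?powR_gt0.
rewrite -exprVn lerXn2r ?nnegrE ?invr_ge0 ?divr_ge0 ?exprn_ge0 ?(ltW y0) //.
by rewrite invf_ple ?posrE ?divr_gt0 ?exprn_gt0 // invf_div ler_pdivrMr // mulrC ltW.
Qed.

End KolmogorovUpper.

Theorem theorem2p3 (R : realType) (T M : R) (l r : nat) (gamma : R) :
  0 < T -> 0 < M -> (2 <= l)%N -> (1 <= r)%N -> 0 < gamma ->
  asymp (fun n => babenko_width n (Qssclass l T r gamma M))
        (fun n => kolmogorov_width n (Qssclass l T r gamma M))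
  /\
  asymp (fun n => kolmogorov_width n (Qssclass l T r gamma M))
        (fun n => (n%:R `^ (- ((sorder r gamma)%:R / l%:R)))%:E).
Proof.
move=> T0 M0 l2 r0 g0; have l0 : (0 < l)%N by exact: leq_trans l2.
set X := Qssclass l T r gamma M; pose a (n : nat) : R := n%:R `^ (- ((sorder r gamma)%:R / l%:R)).
have [c c0 lower] := babenko_width_lower r T0 M0 l0 g0.
have [C C0 upper] := kolmogorov_width_upper T0 M0 l0 r0 g0.
have X0 : X !=set0.
  have [e [eX _]] := @bump_family R l T M r gamma T0 M0 g0 1 isT.
  by eexists; apply: (eX (fun=> 0)) => i; rewrite lexx ler01.
have kol0 n : (0 <= kolmogorov_width n X)%E.
  apply: le_ereal_inf_tmp => _ [L _ <-]; have [x Xx] := X0.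
  apply: le_ereal_sup_tmp; exists (ereal_inf [set `|x - u|%:E | u in L]); first by exists x.
  by apply: le_ereal_inf_tmp => _ [u _ <-]; rewrite lee_fin.
have bk n : (babenko_width n X <= 2%:E * kolmogorov_width n X)%E.
  apply: babenko_le_kolmogorov => //.
  apply: (@class_net R l T X (l%:R * M) _ _ M); first by rewrite mulr_ge0 // ltW.
    by move=> f t u; exact: class_lipschitz.
  by move=> f t; exact: class_bounded.
split.
  (* The lower constant compares the Babenko lower bound with the Kolmogorov upper bound; the upper
     one is [bk]. *)
  exists (c / C), 2; split; rewrite ?divr_gt0 //.
  apply: filterS2 lower upper => n low up; split=> //.
  apply: le_trans low; apply: (@le_trans _ _ ((c / C)%:E * (C * a n)%:E)%E).
    by rewrite lee_wpmul2l // lee_fin ltW // divr_gt0.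
  by rewrite -EFinM lee_fin mulrA divfK // gt_eqF.
(* The Babenko lower bound passes to the Kolmogorov width through [bk], at the cost of a factor
   [2]. *)
exists (c / 2), C; split; rewrite ?divr_gt0 //.
apply: filterS2 lower upper => n low up; split; last by rewrite -EFinM.
have := le_trans low (bk n); case: (kolmogorov_width n X) (kol0 n) => [k| |] //= k0.
  by rewrite -!EFinM !lee_fin -/(a n) mulrAC ler_pdivrMr // mulrC [k * _]mulrC.
by rewrite leey.
Qed.
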